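(* Let $0\le\lambda<\gamma\le\delta$. Every function in $\mathcal{R}_H^0(\gamma,\delta,\lambda)$ is close-to-convex in $\mathcal{U}$.
   Context: Let $\mathcal{U}=\{z\in\mathbb{C}:|z|<1\}$. $\mathcal{H}^0$ denotes the class of complex-valued harmonic functions $\mathfrak{f}=\mathfrak{s}+\overline{\mathfrak{t}}$ on $\mathcal{U}$, where $\mathfrak{s}(z)=z+\sum_{m\ge2}a_mz^m$ and $\mathfrak{t}(z)=\sum_{m\ge2}b_mz^m$ are analytic in $\mathcal{U}$. For real $0\le\lambda<\gamma\le\delta$, $\mathcal{R}_H^0(\gamma,\delta,\lambda)$ is the class of $\mathfrak{f}=\mathfrak{s}+\overline{\mathfrak{t}}\in\mathcal{H}^0$ such that for all $z\in\mathcal{U}$, $\mathrm{Re}\left[\gamma\mathfrak{s}'(z)+\delta z\mathfrak{s}''(z)+\frac{\delta-\gamma}{2}z^2\mathfrak{s}'''(z)-\lambda\right]>\left|\gamma\mathfrak{t}'(z)+\delta z\mathfrak{t}''(z)+\frac{\delta-\gamma}{2}z^2\mathfrak{t}'''(z)\right|$. A harmonic function is close-to-convex in $\mathcal{U}$ if it is univalent in $\mathcal{U}$ and maps $\mathcal{U}$ onto a close-to-convex domain, i.e. a simply connected domain whose complement in $\mathbb{C}$ is a union of non-crossing half-lines. *)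

(* Defs.v *)
From Stdlib Require Import Reals.
From Coquelicot Require Import Coquelicot.
Open Scope R_scope.

Definition unit_disc (z : C) : Prop := Cmod z < 1.

Definition analytic_on_disc (f : C -> C) : Prop :=
  forall z : C, unit_disc z -> @ex_derive C_AbsRing C_NormedModule f z.

Definition D1 (f : C -> C) : C -> C := C_derive f.
Definition D2 (f : C -> C) : C -> C := C_derive (C_derive f).
Definition D3 (f : C -> C) : C -> C := C_derive (C_derive (C_derive f)).

(** The class H^0: s(z) = z + sum_{m>=2} a_m z^m, t(z) = sum_{m>=2} b_m z^m
    analytic in U, i.e. s, t analytic in U with s(0)=0, s'(0)=1,
    t(0)=0, t'(0)=0. *)
Definition in_H0 (s t : C -> C) : Prop :=
  analytic_on_disc s /\ analytic_on_disc t /\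
  s 0%C = 0%C /\ D1 s 0%C = 1%C /\ t 0%C = 0%C /\ D1 t 0%C = 0%C.

Definition harm (s t : C -> C) (z : C) : C := Cplus (s z) (Cconj (t z)).

Definition Lop (gamma delta : R) (g : C -> C) (z : C) : C :=
  Cplus (Cplus (Cmult (RtoC gamma) (D1 g z))
               (Cmult (RtoC delta) (Cmult z (D2 g z))))
        (Cmult (RtoC ((delta - gamma) / 2)) (Cmult (Cmult z z) (D3 g z))).

Definition in_RH0 (gamma delta lambda : R) (s t : C -> C) : Prop :=
  in_H0 s t /\
  forall z : C, unit_disc z ->
    Re (Cminus (Lop gamma delta s z) (RtoC lambda)) > Cmod (Lop gamma delta t z).

Definition univalent_on_disc (f : C -> C) : Prop :=
  forall z w : C, unit_disc z -> unit_disc w -> f z = f w -> z = w.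

Definition image_disc (f : C -> C) (w : C) : Prop :=
  exists z : C, unit_disc z /\ f z = w.

Definition connected_set (D : C -> Prop) : Prop :=
  ~ (exists A B : C -> Prop, open A /\ open B /\
       (forall w, D w -> A w \/ B w) /\
       (exists w, D w /\ A w) /\ (exists w, D w /\ B w) /\
       (forall w, D w -> A w -> B w -> False)).

Definition domain (D : C -> Prop) : Prop := open D /\ connected_set D.

(** A closed loop in D (parametrised by [0,1], extended continuously to R)
    is null-homotopic through closed loops in D. *)
Definition simply_connected (D : C -> Prop) : Prop :=
  forall g : R -> C,
    (forall x : R, continuous g x) ->
    (forall x : R, 0 <= x <= 1 -> D (g x)) ->
    g 0 = g 1 ->
    exists (H : R * R -> C) (c : C),
      (forall p : R * R, continuous H p) /\
      (forall x : R, H (0, x) = g x) /\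
      (forall x : R, H (1, x) = c) /\
      (forall u : R, 0 <= u <= 1 -> H (u, 0) = H (u, 1)) /\
      (forall u x : R, 0 <= u <= 1 -> 0 <= x <= 1 -> D (H (u, x))).

Definition half_line (p d : C) (w : C) : Prop :=
  exists r : R, 0 <= r /\ w = Cplus p (Cmult (RtoC r) d).

Definition crossing (p1 d1 p2 d2 : C) : Prop :=
  Im (Cmult d1 (Cconj d2)) <> 0 /\
  exists w, half_line p1 d1 w /\ half_line p2 d2 w /\ w <> p1 /\ w <> p2.

Definition close_to_convex_domain (D : C -> Prop) : Prop :=
  domain D /\ simply_connected D /\
  exists F : C * C -> Prop,
    (forall pd, F pd -> snd pd <> 0%C) /\
    (forall w, ~ D w <-> exists pd, F pd /\ half_line (fst pd) (snd pd) w) /\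
    (forall pd1 pd2, F pd1 -> F pd2 ->
       ~ crossing (fst pd1) (snd pd1) (fst pd2) (snd pd2)).

Definition close_to_convex_on_disc (f : C -> C) : Prop :=
  univalent_on_disc f /\ close_to_convex_domain (image_disc f).

(* Main.v *)
Require Import Defs.
From Stdlib Require Import Reals Lra Lia Classical ClassicalEpsilon.
From Coquelicot Require Import Coquelicot.
Open Scope R_scope.

(** With [theta = z d/dz], [Lop gamma delta g = (1 + theta) (gamma + (delta - gamma)/2 theta) g'], and an
    operator [a + b theta] with [a > 0], [b >= 0] reflects positivity of the real part. Applied to
    [s + e t] for all unimodular [e], this gives [|t'| < Re s'] on the disc, so that [f = s + conj t]
    satisfies [<f z - f w, z - w> > 0] and is univalent. The variational inequality "[w - f z] is an
    outward normal at [z]" on discs of radius [r -> 1] gives, for each [w] outside the image, a unit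
    vector [zeta] with [<f z - w, z - zeta> >= 0] for all [z]; then the half-line from [w] in direction
    [zeta] avoids the image, and such half-lines do not cross. Since only complex differentiability of
    [s] and [t] is assumed, differentiability of their derivatives is obtained from Goursat's theorem
    and Cauchy's formula. *)

(** * Complex derivatives and derivatives along a real parameter *)

(** Strict monotonicity of [f] carries everything after the bound on [t']: univalence, openness of
    the image, continuity of the inverse and the rays. No inverse function theorem and no boundary
    values of [f] enter. The obstacle is the unit circle, where [f] may be unbounded and
    [Re s' - |t'|] may tend to 0. On a disc of radius r < 1 compactness controls both, and this is
    why continuity of [s'] and [t'] must be known. The normal condition [w - f z = tau z] has no
    evident limit as r -> 1, for it contains [f z] with [z] near the circle. Monotonicity first
    turns it into <f y - w, y - z> >= 0 for all [y] of the disc, where [z] occurs linearly and [tau]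
    not at all; this passes to a cluster point. The freedom in the test point does the rest: the
    midpoint of [zeta] and [z0] shows that [f z0] is not on the ray, the midpoint of two directions
    excludes a crossing. Each point outside the image is the origin of its own ray, so the rays
    cover the complement at once. *)

(** Both notions of derivative below (over C and along a real parameter) are instances of one
    expansion [p h = p0 + l * e h + o(e h)], so that the calculus rules are proved once. *)
Definition first_order {T : Type} (e p : T -> C) (p0 l : C) : Prop :=
  forall eps, 0 < eps -> exists del, 0 < del /\
    forall h : T, Cmod (e h) < del -> Cmod (p h - p0 - l * e h)%C <= eps * Cmod (e h).

Definition cdiff (f : C -> C) (z l : C) : Prop :=
  first_order (fun h : C => h) (fun h => f (z + h)%C) (f z) l.

Definition rdiff (g : R -> C) (t : R) (v : C) : Prop :=
  first_order RtoC (fun h => g (t + h)) (g t) v.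

Lemma Cmod_le_plus (x y z : C) : x = (y + z)%C -> Cmod x <= Cmod y + Cmod z.
Proof. intros ->. apply Cmod_triangle. Qed.

Lemma Cmod_minus_sym (x y : C) : Cmod (x - y)%C = Cmod (y - x)%C.
Proof. rewrite <- Cmod_opp. f_equal. ring. Qed.

Lemma Cmod_dist_triangle (x y z : C) : Cmod (x - z)%C <= Cmod (x - y)%C + Cmod (y - z)%C.
Proof. apply Cmod_le_plus. ring. Qed.

Lemma im_le_Cmod (c : C) : Rabs (Im c) <= Cmod c.
Proof. eapply Rle_trans; [|apply Rmax_Cmod]. apply Rmax_r. Qed.

Lemma Cmod_le_Re_Im (c : C) : Cmod c <= Rabs (Re c) + Rabs (Im c).
Proof.
  rewrite <- (Rabs_pos_eq (Cmod c)) by apply Cmod_ge_0.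
  rewrite <- (Rabs_pos_eq (Rabs (Re c) + Rabs (Im c))).
  2:{ pose proof (Rabs_pos (Re c)); pose proof (Rabs_pos (Im c)); lra. }
  apply Rsqr_le_abs_0. rewrite !Rsqr_pow2, Cmod2_alt, <- (pow2_abs (Re c)), <- (pow2_abs (Im c)).
  pose proof (Rabs_pos (Re c)); pose proof (Rabs_pos (Im c)); nra.
Qed.

Section FirstOrder.
Context {T : Type} (e : T -> C).

Lemma first_order_lipschitz (p : T -> C) (p0 l : C) :
  first_order e p p0 l -> exists del, 0 < del /\
    forall h, Cmod (e h) < del -> Cmod (p h - p0)%C <= (Cmod l + 1) * Cmod (e h).
Proof.
  intros H. destruct (H 1 Rlt_0_1) as [d [Hd Hh]]. exists d. split; [exact Hd|].
  intros h Hl. specialize (Hh h Hl).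
  pose proof (Cmod_le_plus (p h - p0)%C (p h - p0 - l * e h)%C (l * e h)%C ltac:(ring)) as HH.
  rewrite Cmod_mult in HH. lra.
Qed.

Lemma first_order_const (c : C) : first_order e (fun _ => c) c 0%C.
Proof.
  intros eps Heps. exists 1. split; [lra|]. intros h _.
  replace (c - c - 0 * e h)%C with (RtoC 0) by ring. rewrite Cmod_0.
  apply Rmult_le_pos; [lra|apply Cmod_ge_0].
Qed.

Lemma first_order_plus (p q : T -> C) (p0 q0 l m : C) :
  first_order e p p0 l -> first_order e q q0 m ->
  first_order e (fun h => p h + q h)%C (p0 + q0)%C (l + m)%C.
Proof.
  intros Hp Hq eps Heps.
  destruct (Hp (eps / 2)) as [d1 [Hd1 H1]]; [lra|].
  destruct (Hq (eps / 2)) as [d2 [Hd2 H2]]; [lra|].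
  exists (Rmin d1 d2). split; [now apply Rmin_glb_lt|].
  intros h Hh.
  specialize (H1 h (Rlt_le_trans _ _ _ Hh (Rmin_l _ _))).
  specialize (H2 h (Rlt_le_trans _ _ _ Hh (Rmin_r _ _))).
  eapply Rle_trans; [apply (Cmod_le_plus _ (p h - p0 - l * e h)%C (q h - q0 - m * e h)%C); ring|].
  lra.
Qed.

Lemma first_order_mult (p q : T -> C) (p0 q0 l m : C) :
  first_order e p p0 l -> first_order e q q0 m ->
  first_order e (fun h => p h * q h)%C (p0 * q0)%C (l * q0 + p0 * m)%C.
Proof.
  intros Hp Hq eps Heps.
  pose proof (Cmod_ge_0 l) as Pl. pose proof (Cmod_ge_0 m) as Pm.
  pose proof (Cmod_ge_0 p0) as Pp. pose proof (Cmod_ge_0 q0) as Pq.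
  (* The error splits into the two first-order errors, weighted by [q0] and [p0], and the product of
     the increments; each gets a third of [eps]. The [+ 1] keeps the divisors positive when [q0] or
     [p0] vanishes. *)
  destruct (Hp (eps / 3 / (Cmod q0 + 1))) as [d1 [Hd1 H1]].
  { apply Rdiv_lt_0_compat; lra. }
  destruct (Hq (eps / 3 / (Cmod p0 + 1))) as [d2 [Hd2 H2]].
  { apply Rdiv_lt_0_compat; lra. }
  destruct (first_order_lipschitz _ _ _ Hp) as [d3 [Hd3 H3]].
  destruct (first_order_lipschitz _ _ _ Hq) as [d4 [Hd4 H4]].
  set (K := (Cmod l + 1) * (Cmod m + 1)).
  assert (HK : 0 < K) by (apply Rmult_lt_0_compat; lra).
  assert (Hd5 : 0 < eps / 3 / K) by (apply Rdiv_lt_0_compat; lra).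
  exists (Rmin (Rmin d1 d2) (Rmin (Rmin d3 d4) (eps / 3 / K))).
  split; [repeat apply Rmin_glb_lt; assumption|].
  intros h Hh.
  apply Rmin_Rgt in Hh. destruct Hh as [Hh1 Hh2].
  apply Rmin_Rgt in Hh1. destruct Hh1 as [Hh1 Hh1'].
  apply Rmin_Rgt in Hh2. destruct Hh2 as [Hh2 Hh5].
  apply Rmin_Rgt in Hh2. destruct Hh2 as [Hh3 Hh4].
  specialize (H1 h Hh1). specialize (H2 h Hh1'). specialize (H3 h Hh3). specialize (H4 h Hh4).
  pose proof (Cmod_ge_0 (e h)) as Pe.
  eapply Rle_trans; [apply (Cmod_le_plus _ ((p h - p0 - l * e h) * q0 + p0 * (q h - q0 - m * e h))%C
     ((p h - p0) * (q h - q0))%C); ring|].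
  eapply Rle_trans; [apply Rplus_le_compat_r, Cmod_triangle|].
  rewrite !Cmod_mult.
  assert (A1 : Cmod (p h - p0 - l * e h)%C * Cmod q0 <= eps / 3 * Cmod (e h)).
  { eapply Rle_trans; [apply Rmult_le_compat_r; [exact Pq|exact H1]|].
    replace (eps / 3 / (Cmod q0 + 1) * Cmod (e h) * Cmod q0)
      with (eps / 3 * Cmod (e h) * (Cmod q0 / (Cmod q0 + 1))) by (field; lra).
    rewrite <- (Rmult_1_r (eps / 3 * Cmod (e h))) at 2.
    apply Rmult_le_compat_l; [apply Rmult_le_pos; lra|].
    apply Rle_div_l; lra. }
  assert (A2 : Cmod p0 * Cmod (q h - q0 - m * e h)%C <= eps / 3 * Cmod (e h)).
  { eapply Rle_trans; [apply Rmult_le_compat_l; [exact Pp|exact H2]|].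
    replace (Cmod p0 * (eps / 3 / (Cmod p0 + 1) * Cmod (e h)))
      with (eps / 3 * Cmod (e h) * (Cmod p0 / (Cmod p0 + 1))) by (field; lra).
    rewrite <- (Rmult_1_r (eps / 3 * Cmod (e h))) at 2.
    apply Rmult_le_compat_l; [apply Rmult_le_pos; lra|].
    apply Rle_div_l; lra. }
  assert (A3 : Cmod (p h - p0)%C * Cmod (q h - q0)%C <= eps / 3 * Cmod (e h)).
  { eapply Rle_trans; [apply Rmult_le_compat; [apply Cmod_ge_0|apply Cmod_ge_0|exact H3|exact H4]|].
    replace ((Cmod l + 1) * Cmod (e h) * ((Cmod m + 1) * Cmod (e h)))
      with (K * Cmod (e h) * Cmod (e h)) by (unfold K; ring).
    apply Rmult_le_compat_r; [exact Pe|].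
    apply Rlt_le in Hh5. apply (Rmult_le_compat_l K) in Hh5; [|lra].
    replace (K * (eps / 3 / K)) with (eps / 3) in Hh5 by (field; lra). exact Hh5. }
  lra.
Qed.

(** The inner map stays generic over [T], so that this is at once the chain rule over C and the rule
    for a holomorphic function along a real curve. *)
Lemma first_order_comp (F : C -> C) (p : T -> C) (p0 l v : C) :
  cdiff F p0 l -> first_order e p p0 v -> first_order e (fun h => F (p h)) (F p0) (l * v)%C.
Proof.
  intros HF Hp eps Heps.
  pose proof (Cmod_ge_0 l) as Pl. pose proof (Cmod_ge_0 v) as Pv.
  destruct (HF (eps / 2 / (Cmod v + 1))) as [d1 [Hd1 H1]].
  { apply Rdiv_lt_0_compat; lra. }
  destruct (Hp (eps / 2 / (Cmod l + 1))) as [d2 [Hd2 H2]].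
  { apply Rdiv_lt_0_compat; lra. }
  destruct (first_order_lipschitz _ _ _ Hp) as [d3 [Hd3 H3]].
  assert (Hd4 : 0 < d1 / (Cmod v + 1)) by (apply Rdiv_lt_0_compat; lra).
  exists (Rmin (Rmin d2 d3) (d1 / (Cmod v + 1))).
  split; [repeat apply Rmin_glb_lt; assumption|].
  intros h Hh.
  apply Rmin_Rgt in Hh. destruct Hh as [Hh2 Hh4].
  apply Rmin_Rgt in Hh2. destruct Hh2 as [Hh2 Hh3].
  specialize (H2 h Hh2). specialize (H3 h Hh3).
  pose proof (Cmod_ge_0 (e h)) as Pe.
  assert (Hs : Cmod (p h - p0)%C < d1).
  { eapply Rle_lt_trans; [exact H3|].
    apply (Rmult_lt_compat_l (Cmod v + 1)) in Hh4; [|lra].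
    replace ((Cmod v + 1) * (d1 / (Cmod v + 1))) with d1 in Hh4 by (field; lra). exact Hh4. }
  specialize (H1 _ Hs). cbv beta in H1. replace (p0 + (p h - p0))%C with (p h) in H1 by ring.
  eapply Rle_trans; [apply (Cmod_le_plus _ (F (p h) - F p0 - l * (p h - p0))%C
     (l * (p h - p0 - v * e h))%C); ring|].
  rewrite Cmod_mult.
  assert (A1 : eps / 2 / (Cmod v + 1) * Cmod (p h - p0)%C <= eps / 2 * Cmod (e h)).
  { eapply Rle_trans; [apply Rmult_le_compat_l; [apply Rlt_le, Rdiv_lt_0_compat; lra|exact H3]|].
    apply Req_le. field. lra. }
  assert (A2 : Cmod l * Cmod (p h - p0 - v * e h)%C <= eps / 2 * Cmod (e h)).
  { eapply Rle_trans; [apply Rmult_le_compat_l; [exact Pl|exact H2]|].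
    replace (Cmod l * (eps / 2 / (Cmod l + 1) * Cmod (e h)))
      with (eps / 2 * Cmod (e h) * (Cmod l / (Cmod l + 1))) by (field; lra).
    rewrite <- (Rmult_1_r (eps / 2 * Cmod (e h))) at 2.
    apply Rmult_le_compat_l; [apply Rmult_le_pos; lra|].
    apply Rle_div_l; lra. }
  lra.
Qed.

End FirstOrder.

Lemma cdiff_const (c z : C) : cdiff (fun _ => c) z 0%C.
Proof. apply first_order_const. Qed.

Lemma cdiff_id (z : C) : cdiff (fun w => w) z 1%C.
Proof.
  intros eps Heps. exists 1. split; [lra|]. intros h _.
  replace (z + h - z - 1 * h)%C with (RtoC 0) by ring. rewrite Cmod_0.
  apply Rmult_le_pos; [lra|apply Cmod_ge_0].
Qed.

Lemma cdiff_plus (f g : C -> C) (z l m : C) :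
  cdiff f z l -> cdiff g z m -> cdiff (fun w => f w + g w)%C z (l + m)%C.
Proof. apply first_order_plus. Qed.

Lemma cdiff_mult (f g : C -> C) (z l m : C) :
  cdiff f z l -> cdiff g z m -> cdiff (fun w => f w * g w)%C z (l * g z + f z * m)%C.
Proof. apply (first_order_mult (fun h : C => h) (fun h => f (z + h)%C) (fun h => g (z + h)%C)). Qed.

Lemma cdiff_comp (f g : C -> C) (z l m : C) :
  cdiff f (g z) l -> cdiff g z m -> cdiff (fun w => f (g w)) z (l * m)%C.
Proof. apply (first_order_comp (fun h : C => h) f (fun h => g (z + h)%C)). Qed.

Lemma cdiff_eq (f : C -> C) (z l m : C) : cdiff f z l -> l = m -> cdiff f z m.
Proof. now intros H <-. Qed.

Lemma cdiff_scal (c : C) (f : C -> C) (z l : C) :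
  cdiff f z l -> cdiff (fun w => c * f w)%C z (c * l)%C.
Proof.
  intros H. eapply cdiff_eq; [apply cdiff_mult; [apply cdiff_const|exact H]|]. cbv beta; ring.
Qed.

Lemma cdiff_ext_loc (f g : C -> C) (z l : C) (r : R) :
  0 < r -> (forall w, Cmod (w - z)%C < r -> f w = g w) -> cdiff f z l -> cdiff g z l.
Proof.
  intros Hr He H eps Heps. destruct (H eps Heps) as [d [Hd Hh]].
  exists (Rmin d r). split; [now apply Rmin_glb_lt|].
  intros h Hl. apply Rmin_Rgt in Hl. destruct Hl as [H1 H2].
  rewrite <- !He. now apply Hh.
  replace (z - z)%C with (RtoC 0) by ring. rewrite Cmod_0; lra.
  replace (z + h - z)%C with h by ring. exact H2.
Qed.

Lemma cdiff_opp (f : C -> C) (z l : C) : cdiff f z l -> cdiff (fun w => - f w)%C z (- l)%C.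
Proof.
  intros H. eapply cdiff_ext_loc with (r := 1) (f := fun w => (- (1) * f w)%C); [lra|intros; ring|].
  eapply cdiff_eq; [apply cdiff_scal, H|ring].
Qed.

Lemma cdiff_minus (f g : C -> C) (z l m : C) :
  cdiff f z l -> cdiff g z m -> cdiff (fun w => f w - g w)%C z (l - m)%C.
Proof. intros Hf Hg. apply cdiff_plus; [exact Hf|now apply cdiff_opp]. Qed.

Lemma rdiff_plus (f g : R -> C) (t : R) (l m : C) :
  rdiff f t l -> rdiff g t m -> rdiff (fun w => f w + g w)%C t (l + m)%C.
Proof. apply first_order_plus. Qed.

Lemma rdiff_mult (f g : R -> C) (t : R) (l m : C) :
  rdiff f t l -> rdiff g t m -> rdiff (fun w => f w * g w)%C t (l * g t + f t * m)%C.
Proof. apply (first_order_mult RtoC (fun h => f (t + h)) (fun h => g (t + h))). Qed.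

Lemma rdiff_comp (F : C -> C) (g : R -> C) (t : R) (l v : C) :
  cdiff F (g t) l -> rdiff g t v -> rdiff (fun w => F (g w)) t (l * v)%C.
Proof. apply (first_order_comp RtoC F (fun h => g (t + h))). Qed.

Lemma rdiff_eq (f : R -> C) (t : R) (l m : C) : rdiff f t l -> l = m -> rdiff f t m.
Proof. now intros H <-. Qed.

Lemma rdiff_minus (f g : R -> C) (t : R) (l m : C) :
  rdiff f t l -> rdiff g t m -> rdiff (fun w => f w - g w)%C t (l - m)%C.
Proof.
  intros Hf Hg. apply rdiff_plus; [exact Hf|].
  eapply rdiff_eq; [apply (rdiff_comp Copp); [apply (cdiff_opp (fun w => w)), cdiff_id|exact Hg]|].
  ring.
Qed.

Lemma rdiff_const (c : C) (t : R) : rdiff (fun _ => c) t 0%C.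
Proof. apply first_order_const. Qed.

Lemma rdiff_RtoC (t : R) : rdiff RtoC t 1%C.
Proof.
  intros eps Heps. exists 1. split; [lra|]. intros h _.
  replace (RtoC (t + h) - t - 1 * h)%C with (RtoC 0) by (rewrite RtoC_plus; ring). rewrite Cmod_0.
  apply Rmult_le_pos; [lra|apply Cmod_ge_0].
Qed.

Lemma rdiff_affine (p d : C) (t : R) : rdiff (fun t => p + t * d)%C t d.
Proof.
  eapply rdiff_eq; [apply rdiff_plus; [apply rdiff_const|
    apply rdiff_mult; [apply rdiff_RtoC|apply rdiff_const]]|]. cbv beta; ring.
Qed.

Lemma cdiff_inv (a : C) : a <> 0%C -> cdiff Cinv a (- / (a * a))%C.
Proof.
  intros Ha eps Heps. pose proof (proj1 (Cmod_gt_0 a) Ha) as Pa.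
  set (d := Rmin (Cmod a / 2) (eps * (Cmod a * Cmod a * Cmod a) / 2)).
  assert (P3 : 0 < Cmod a * Cmod a * Cmod a) by (repeat apply Rmult_lt_0_compat; lra).
  assert (P4 : 0 < eps * (Cmod a * Cmod a * Cmod a)) by (apply Rmult_lt_0_compat; lra).
  exists d. split. { apply Rmin_glb_lt; lra. }
  intros h Hh.
  assert (H1 : Cmod h < Cmod a / 2) by (eapply Rlt_le_trans; [exact Hh|apply Rmin_l]).
  assert (H2 : Cmod h < eps * (Cmod a * Cmod a * Cmod a) / 2) by (eapply Rlt_le_trans; [exact Hh|apply Rmin_r]).
  assert (H3 : Cmod a / 2 < Cmod (a + h)%C).
  { pose proof (Cmod_le_plus a (a + h)%C (- h)%C ltac:(ring)) as HH. rewrite Cmod_opp in HH. lra. }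
  assert (Hah : (a + h)%C <> 0%C) by (apply Cmod_gt_0; lra).
  replace (/ (a + h) - / a - - / (a * a) * h)%C with (h * (h / (a * a * (a + h))))%C.
  2:{ field. split; assumption. }
  rewrite Cmod_mult, (Rmult_comm eps). apply Rmult_le_compat_l; [apply Cmod_ge_0|].
  rewrite Cmod_div by (repeat apply Cmult_neq_0; assumption).
  rewrite !Cmod_mult.
  assert (P5 : 0 < Cmod a * Cmod a) by (apply Rmult_lt_0_compat; lra).
  apply Rle_div_l; [apply Rmult_lt_0_compat; lra|].
  assert (Cmod a * Cmod a * (Cmod a / 2) <= Cmod a * Cmod a * Cmod (a + h)%C) by (apply Rmult_le_compat_l; lra).
  assert (eps * (Cmod a * Cmod a * (Cmod a / 2)) <= eps * (Cmod a * Cmod a * Cmod (a + h)%C)) by (apply Rmult_le_compat_l; lra).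
  lra.
Qed.

Lemma cdiff_continuous (f : C -> C) (z l : C) :
  cdiff f z l -> forall eps, 0 < eps -> exists del, 0 < del /\
    forall w, Cmod (w - z)%C < del -> Cmod (f w - f z)%C < eps.
Proof.
  intros H eps Heps. destruct (first_order_lipschitz _ _ _ _ H) as [d [Hd Hh]].
  pose proof (Cmod_ge_0 l) as Pl.
  assert (Hd4 : 0 < eps / (Cmod l + 1)) by (apply Rdiv_lt_0_compat; lra).
  exists (Rmin d (eps / (Cmod l + 1))). split; [now apply Rmin_glb_lt|].
  intros w Hw. apply Rmin_Rgt in Hw. destruct Hw as [Hw1 Hw2].
  specialize (Hh _ Hw1). cbv beta in Hh. replace (z + (w - z))%C with w in Hh by ring.
  eapply Rle_lt_trans; [exact Hh|].
  apply (Rmult_lt_compat_l (Cmod l + 1)) in Hw2; [|lra].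
  replace ((Cmod l + 1) * (eps / (Cmod l + 1))) with eps in Hw2 by (field; lra). exact Hw2.
Qed.

(** * Comparison with the derivatives of Coquelicot *)

Lemma cdiff_is_derive (f : C -> C) (z l : C) :
  cdiff f z l <-> @is_derive C_AbsRing C_NormedModule f z l.
Proof.
  split.
  - intros H. split.
    + apply is_linear_scal_l.
    (* The expansion is asked for at every limit [x] of the filter [locally z]; uniqueness of limits
       identifies [x] with [z]. *)
    + intros x Hx. apply (@is_filter_lim_locally_unique C_AbsRing (AbsRing_NormedModule C_AbsRing)) in Hx.
      rewrite <- Hx. clear x Hx.
      intros eps. destruct (H eps (cond_pos eps)) as [del [Hd Hh]].
      exists (mkposreal del Hd). refine (fun (y : C) Hy => _).
      assert (Hy' : Cmod (y - z)%C < del) by exact Hy.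
      specialize (Hh _ Hy'). cbv beta in Hh.
      replace (z + (y - z))%C with y in Hh by ring.
      change (Cmod (f y - f z - (y - z) * l)%C <= eps * Cmod (y - z)%C).
      rewrite (Cmult_comm (y - z) l). exact Hh.
  - intros [_ H] eps Heps. specialize (H z (fun P HP => HP) (mkposreal eps Heps)).
    destruct H as [[del Hd] H]. exists del. split; [exact Hd|].
    intros h Hh. assert (Hb : Cmod (z + h - z)%C < del) by (replace (z + h - z)%C with h by ring; exact Hh).
    specialize (H (z + h)%C Hb).
    change (Cmod (f (z + h) - f z - (z + h - z) * l)%C <= eps * Cmod (z + h - z)%C) in H.
    replace (z + h - z)%C with h in H by ring. rewrite Cmult_comm. exact H.
Qed.

(** Along a real parameter, C is the product module of two copies of R; its norm is Euclidean, so
    bounds stated with [norm] pass to [Cmod]. *)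
Lemma C_R_norm (x : C) : @norm R_AbsRing C_R_NormedModule x = Cmod x.
Proof.
  unfold Cmod. change (sqrt (Rabs (fst x) ^ 2 + Rabs (snd x) ^ 2) = sqrt (fst x ^ 2 + snd x ^ 2)).
  now rewrite !pow2_abs.
Qed.

Lemma rdiff_is_derive (g : R -> C) (t : R) (v : C) :
  rdiff g t v -> @is_derive R_AbsRing C_R_NormedModule g t v.
Proof.
  intros H. split.
  - apply is_linear_scal_l.
  - intros x Hx. apply (@is_filter_lim_locally_unique R_AbsRing (AbsRing_NormedModule R_AbsRing)) in Hx.
    rewrite <- Hx. clear x Hx.
    intros eps. destruct (H eps (cond_pos eps)) as [del [Hd Hh]].
    exists (mkposreal del Hd). refine (fun (y : R) Hy => _).
    assert (Hy' : Cmod (RtoC (y - t)) < del) by (rewrite Cmod_R; exact Hy).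
    specialize (Hh _ Hy'). rewrite Cmod_R in Hh.
    replace (t + (y - t)) with y in Hh by ring.
    rewrite C_R_norm. change (norm (minus y t)) with (Rabs (y - t)).
    eapply Rle_trans; [|exact Hh]. apply Req_le. f_equal.
    apply injective_projections; simpl; unfold minus, plus, opp, scal; simpl; unfold mult; simpl; ring.
Qed.

Lemma rdiff_components (g : R -> C) (t : R) (a b : R) :
  is_derive (fun t => fst (g t)) t a -> is_derive (fun t => snd (g t)) t b -> rdiff g t (a, b).
Proof.
  intros [_ H1] [_ H2] eps Heps.
  assert (Heps2 : 0 < eps / 2) by lra.
  destruct (H1 t (fun P HP => HP) (mkposreal _ Heps2)) as [[d1 Hd1] K1].
  destruct (H2 t (fun P HP => HP) (mkposreal _ Heps2)) as [[d2 Hd2] K2].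
  exists (Rmin d1 d2). split; [now apply Rmin_glb_lt|].
  intros h Hh. rewrite Cmod_R in Hh. rewrite Cmod_R.
  apply Rmin_Rgt in Hh. destruct Hh as [Hh1 Hh2].
  assert (E : t + h - t = h) by ring.
  assert (B1 : Rabs (t + h - t) < d1) by (rewrite E; exact Hh1).
  assert (B2 : Rabs (t + h - t) < d2) by (rewrite E; exact Hh2).
  specialize (K1 (t + h) B1). specialize (K2 (t + h) B2).
  change (Rabs (fst (g (t + h)) - fst (g t) - (t + h - t) * a) <= eps / 2 * Rabs (t + h - t)) in K1.
  change (Rabs (snd (g (t + h)) - snd (g t) - (t + h - t) * b) <= eps / 2 * Rabs (t + h - t)) in K2.
  rewrite E in K1, K2.
  eapply Rle_trans; [apply Cmod_le_Re_Im|].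
  replace (Re (g (t + h)%R - g t - (a, b) * h)%C) with (fst (g (t + h)) - fst (g t) - h * a) by (simpl; ring).
  replace (Im (g (t + h)%R - g t - (a, b) * h)%C) with (snd (g (t + h)) - snd (g t) - h * b) by (simpl; ring).
  lra.
Qed.

Lemma rdiff_Re (g : R -> C) (t : R) (v : C) : rdiff g t v -> is_derive (fun t => Re (g t)) t (Re v).
Proof.
  intros H. split.
  - apply is_linear_scal_l.
  - intros x Hx. apply (@is_filter_lim_locally_unique R_AbsRing (AbsRing_NormedModule R_AbsRing)) in Hx.
    rewrite <- Hx. clear x Hx.
    intros eps. destruct (H eps (cond_pos eps)) as [del [Hd Hh]].
    exists (mkposreal del Hd). refine (fun (y : R) Hy => _).
    assert (Hy' : Cmod (RtoC (y - t)) < del) by (rewrite Cmod_R; exact Hy).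
    specialize (Hh _ Hy'). rewrite Cmod_R in Hh.
    replace (t + (y - t)) with y in Hh by ring.
    change (Rabs (Re (g y) - Re (g t) - (y - t) * Re v) <= eps * Rabs (y - t)).
    eapply Rle_trans; [|exact Hh]. eapply Rle_trans; [|apply re_le_Cmod].
    apply Req_le. f_equal. unfold Re; simpl. ring.
Qed.

Lemma rdiff_continuous (g : R -> C) (t : R) (v : C) :
  rdiff g t v -> @continuous R_UniformSpace C_UniformSpace g t.
Proof.
  intros H. apply rdiff_is_derive in H.
  apply (@ex_derive_continuous R_AbsRing C_R_NormedModule). now exists v.
Qed.

(** * Integrals along segments *)

(** The derivative is carried as a function, so that it can itself be integrated and differentiated;
    its values outside the disc are arbitrary. *)
Definition holo (f f' : C -> C) : Prop := forall z, unit_disc z -> cdiff f z (f' z).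

Lemma holo_const (c : C) : holo (fun _ => c) (fun _ => 0%C).
Proof. intros z _. apply cdiff_const. Qed.

Lemma holo_plus (f f' g g' : C -> C) :
  holo f f' -> holo g g' -> holo (fun w => f w + g w)%C (fun w => f' w + g' w)%C.
Proof. intros Hf Hg z Hz. apply cdiff_plus; auto. Qed.

Lemma holo_minus (f f' g g' : C -> C) :
  holo f f' -> holo g g' -> holo (fun w => f w - g w)%C (fun w => f' w - g' w)%C.
Proof. intros Hf Hg z Hz. apply cdiff_minus; auto. Qed.

Lemma holo_scal (c : C) (f f' : C -> C) : holo f f' -> holo (fun z => c * f z)%C (fun z => c * f' z)%C.
Proof. intros Hf z Hz. apply cdiff_scal, Hf, Hz. Qed.

Notation CInt := (@RInt C_R_CompleteNormedModule).
Notation ex_CInt := (@ex_RInt C_R_NormedModule).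

Lemma ex_CInt_rdiff (g : R -> C) (a b : R) :
  a <= b -> (forall t, a <= t <= b -> exists v, rdiff g t v) -> ex_CInt g a b.
Proof.
  intros Hab H. apply (@ex_RInt_continuous C_R_CompleteNormedModule).
  rewrite Rmin_left, Rmax_right by lra. intros t Ht. destruct (H t Ht) as [v Hv].
  exact (rdiff_continuous _ _ _ Hv).
Qed.

Lemma CInt_FTC (G g : R -> C) (a b : R) :
  a <= b -> (forall t, a <= t <= b -> rdiff G t (g t)) ->
  (forall t, a <= t <= b -> exists v, rdiff g t v) -> CInt g a b = (G b - G a)%C.
Proof.
  intros Hab HG Hg. apply (@is_RInt_unique C_R_CompleteNormedModule).
  apply (@is_RInt_derive C_R_CompleteNormedModule);
    rewrite Rmin_left, Rmax_right by lra; intros t Ht.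
  - apply rdiff_is_derive, HG, Ht.
  - destruct (Hg t Ht) as [v Hv]. exact (rdiff_continuous _ _ _ Hv).
Qed.

Lemma CInt_bound (g : R -> C) (a b M : R) :
  a <= b -> ex_CInt g a b -> (forall t, a <= t <= b -> Cmod (g t) <= M) ->
  Cmod (CInt g a b) <= M * (b - a).
Proof.
  intros Hab He HM. rewrite <- C_R_norm, Rmult_comm.
  apply (@norm_RInt_le_const C_R_CompleteNormedModule g a b); [exact Hab| |].
  - intros t Ht. rewrite C_R_norm. now apply HM.
  - now apply (@RInt_correct C_R_CompleteNormedModule).
Qed.

Lemma CInt_minus (g h : R -> C) (a b : R) :
  ex_CInt g a b -> ex_CInt h a b ->
  CInt (fun t => g t - h t)%C a b = (CInt g a b - CInt h a b)%C.
Proof. apply (@RInt_minus C_R_CompleteNormedModule). Qed.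

(** Linearity over the real module gives real factors only; a complex factor mixes the two
    components, hence the computation on real and imaginary parts. *)
Lemma CInt_scal (c : C) (g : R -> C) (a b : R) :
  ex_CInt g a b -> CInt (fun t => c * g t)%C a b = (c * CInt g a b)%C.
Proof.
  intros [l Hl]. rewrite (@is_RInt_unique C_R_CompleteNormedModule _ _ _ _ Hl).
  apply (@is_RInt_unique C_R_CompleteNormedModule).
  pose proof (is_RInt_fct_extend_fst _ _ _ _ Hl) as H1.
  pose proof (is_RInt_fct_extend_snd _ _ _ _ Hl) as H2.
  apply (@is_RInt_fct_extend_pair R_NormedModule R_NormedModule); simpl.
  - exact (is_RInt_minus _ _ _ _ _ _ (is_RInt_scal _ _ _ (fst c) _ H1) (is_RInt_scal _ _ _ (snd c) _ H2)).
  - exact (is_RInt_plus _ _ _ _ _ _ (is_RInt_scal _ _ _ (fst c) _ H2) (is_RInt_scal _ _ _ (snd c) _ H1)).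
Qed.

Lemma Cmod_convex (p q : C) (t r : R) :
  0 <= t <= 1 -> Cmod p <= r -> Cmod q <= r -> Cmod (p + t * (q - p))%C <= r.
Proof.
  intros Ht Hp Hq.
  eapply Rle_trans; [apply (Cmod_le_plus _ ((1 - t)%R * p)%C (t * q)%C)|].
  { rewrite RtoC_minus. ring. }
  rewrite !Cmod_mult, !Cmod_R, !Rabs_pos_eq by lra. nra.
Qed.

Lemma unit_disc_convex (p q : C) (t : R) :
  0 <= t <= 1 -> unit_disc p -> unit_disc q -> unit_disc (p + t * (q - p))%C.
Proof.
  intros Ht Hp Hq. unfold unit_disc in *.
  eapply Rle_lt_trans; [apply (Cmod_convex p q t (Rmax (Cmod p) (Cmod q)) Ht)|].
  apply Rmax_l. apply Rmax_r. now apply Rmax_lub_lt.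
Qed.

Definition seg_int (f : C -> C) (p q : C) : C := CInt (fun t => f (p + t * (q - p)) * (q - p))%C 0 1.

Section SegmentIntegrals.
Variables (f f' : C -> C) (Hf : holo f f').

Lemma seg_integrand_rdiff (p d : C) (t : R) :
  unit_disc (p + t * d)%C -> exists v, rdiff (fun t => f (p + t * d) * d)%C t v.
Proof.
  intros H. eexists. apply rdiff_mult; [|apply rdiff_const].
  apply (rdiff_comp f); [apply Hf, H|apply rdiff_affine].
Qed.

Lemma seg_ex (p q : C) (a b : R) : unit_disc p -> unit_disc q -> 0 <= a -> a <= b -> b <= 1 ->
  ex_CInt (fun t => f (p + t * (q - p)) * (q - p))%C a b.
Proof.
  intros Hp Hq Ha Hab Hb. apply ex_CInt_rdiff; [lra|]. intros t Ht.
  apply seg_integrand_rdiff, unit_disc_convex; trivial; lra.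
Qed.

Lemma seg_int_primitive (F : C -> C) (p q : C) : holo F f -> unit_disc p -> unit_disc q ->
  seg_int f p q = (F q - F p)%C.
Proof.
  intros HF Hp Hq. unfold seg_int.
  rewrite (CInt_FTC (fun t => F (p + t * (q - p))%C)); [f_equal; [f_equal; ring| f_equal; f_equal; ring]|lra| |].
  - intros t Ht. apply (rdiff_comp F); [apply HF, unit_disc_convex; trivial|apply rdiff_affine].
  - intros t Ht. apply seg_integrand_rdiff, unit_disc_convex; trivial.
Qed.

Lemma seg_int_bound (p q : C) (M : R) : unit_disc p -> unit_disc q ->
  (forall t, 0 <= t <= 1 -> Cmod (f (p + t * (q - p))%C) <= M) ->
  Cmod (seg_int f p q) <= M * Cmod (q - p)%C.
Proof.
  intros Hp Hq HM.
  replace (M * Cmod (q - p)%C) with (M * Cmod (q - p)%C * (1 - 0)) by ring.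
  apply CInt_bound; [lra|apply seg_ex; trivial; lra|].
  intros t Ht. rewrite Cmod_mult. apply Rmult_le_compat_r; [apply Cmod_ge_0|]. now apply HM.
Qed.

Lemma seg_ex_any (p q : C) (a b : R) : unit_disc p -> unit_disc q -> 0 <= a <= 1 -> 0 <= b <= 1 ->
  ex_CInt (fun t => f (p + t * (q - p)) * (q - p))%C a b.
Proof.
  intros Hp Hq Ha Hb. destruct (Rle_dec a b).
  - apply seg_ex; trivial; lra.
  - apply (@ex_RInt_swap C_R_NormedModule), seg_ex; trivial; lra.
Qed.

(** An affine change of parameter. Since [a > b] is allowed, reversal of a segment is the case
    [a = 1], [b = 0], and subdivision becomes Chasles' relation for one integrand. *)
Lemma seg_int_sub (p q : C) (a b : R) : unit_disc p -> unit_disc q -> 0 <= a <= 1 -> 0 <= b <= 1 ->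
  seg_int f (p + a * (q - p))%C (p + b * (q - p))%C
  = CInt (fun t => f (p + t * (q - p)) * (q - p))%C a b.
Proof.
  intros Hp Hq Ha Hb. unfold seg_int.
  pose proof (@RInt_comp_lin C_R_CompleteNormedModule (fun t => f (p + t * (q - p)) * (q - p))%C (b - a) a 0 1) as H.
  replace ((b - a) * 0 + a) with a in H by ring. replace ((b - a) * 1 + a) with b in H by ring.
  rewrite <- H by (apply seg_ex_any; trivial).
  apply (@RInt_ext C_R_CompleteNormedModule). intros t _.
  replace (p + a * (q - p) + t * (p + b * (q - p) - (p + a * (q - p))))%C
    with (p + ((b - a) * t + a)%R * (q - p))%C by (rewrite RtoC_plus, RtoC_mult, RtoC_minus; ring).
  set (w := f _).
  apply injective_projections; simpl; unfold scal; simpl; unfold mult; simpl; ring.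
Qed.

Lemma seg_int_swap (p q : C) : unit_disc p -> unit_disc q -> seg_int f q p = (- seg_int f p q)%C.
Proof.
  intros Hp Hq.
  pose proof (seg_int_sub p q 1 0 Hp Hq ltac:(lra) ltac:(lra)) as H.
  replace (p + 1%R * (q - p))%C with q in H by ring. replace (p + 0%R * (q - p))%C with p in H by ring.
  rewrite H. unfold seg_int. symmetry. apply (@opp_RInt_swap C_R_CompleteNormedModule).
  apply seg_ex; trivial; lra.
Qed.

Lemma seg_int_split (p q : C) (a : R) : unit_disc p -> unit_disc q -> 0 <= a <= 1 ->
  seg_int f p q = (seg_int f p (p + a * (q - p)) + seg_int f (p + a * (q - p)) q)%C.
Proof.
  intros Hp Hq Ha.
  pose proof (seg_int_sub p q 0 a Hp Hq ltac:(lra) Ha) as H1.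
  pose proof (seg_int_sub p q a 1 Hp Hq Ha ltac:(lra)) as H2.
  replace (p + 1%R * (q - p))%C with q in H2 by ring. replace (p + 0%R * (q - p))%C with p in H1 by ring.
  rewrite H1, H2. symmetry. apply (@RInt_Chasles C_R_CompleteNormedModule); apply seg_ex_any; trivial; lra.
Qed.

End SegmentIntegrals.

Lemma Cmult_minus_distr_r (x y z : C) : ((x - y) * z = x * z - y * z)%C.
Proof. ring. Qed.

Lemma seg_int_minus (f f' g g' : C -> C) (p q : C) :
  holo f f' -> holo g g' -> unit_disc p -> unit_disc q ->
  seg_int (fun w => f w - g w)%C p q = (seg_int f p q - seg_int g p q)%C.
Proof.
  intros Hf Hg Hp Hq. unfold seg_int.
  rewrite <- CInt_minus by (eapply seg_ex; eauto; lra).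
  apply (@RInt_ext C_R_CompleteNormedModule). intros t _. apply Cmult_minus_distr_r.
Qed.

(** * Triangles and their subdivision at the midpoints *)

Definition tri_int (f : C -> C) (p q r : C) : C := (seg_int f p q + seg_int f q r + seg_int f r p)%C.

Definition perimeter (p q r : C) : R := Cmod (q - p)%C + Cmod (r - q)%C + Cmod (p - r)%C.

Definition mid (p q : C) : C := (p + (/ 2)%R * (q - p))%C.

Lemma unit_disc_mid (p q : C) : unit_disc p -> unit_disc q -> unit_disc (mid p q).
Proof. intros. apply unit_disc_convex; trivial; lra. Qed.

Lemma mid_sym (p q : C) : mid p q = mid q p.
Proof. apply injective_projections; simpl; field. Qed.

(** Each edge of the medial triangle is also run through by one corner triangle, in the opposite
    direction, and cancels; the halves of the outer edges add up. *)
Lemma tri_int_split (f f' : C -> C) (p q r : C) :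
  holo f f' -> unit_disc p -> unit_disc q -> unit_disc r ->
  tri_int f p q r =
  (tri_int f p (mid p q) (mid p r) + tri_int f q (mid q r) (mid q p)
   + tri_int f r (mid r p) (mid r q) + tri_int f (mid p q) (mid q r) (mid r p))%C.
Proof.
  intros Hf Hp Hq Hr. rewrite (mid_sym q p), (mid_sym r q), (mid_sym p r). unfold tri_int.
  pose proof (unit_disc_mid p q Hp Hq). pose proof (unit_disc_mid q r Hq Hr).
  pose proof (unit_disc_mid r p Hr Hp).
  rewrite (seg_int_split f f' Hf p q (/ 2)) by (trivial; lra).
  rewrite (seg_int_split f f' Hf q r (/ 2)) by (trivial; lra).
  rewrite (seg_int_split f f' Hf r p (/ 2)) by (trivial; lra).
  fold (mid p q) (mid q r) (mid r p).
  rewrite (seg_int_swap f f' Hf (mid r p) (mid p q)) by trivial.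
  rewrite (seg_int_swap f f' Hf (mid p q) (mid q r)) by trivial.
  rewrite (seg_int_swap f f' Hf (mid q r) (mid r p)) by trivial.
  ring.
Qed.

Lemma Cmod_half (x y z : C) : x = ((/ 2)%R * (y - z))%C -> Cmod x = Cmod (y - z)%C / 2.
Proof. intros ->. rewrite Cmod_mult, Cmod_R, Rabs_pos_eq by lra. lra. Qed.

Lemma perimeter_corner (p q r : C) : perimeter p (mid p q) (mid p r) = perimeter p q r / 2.
Proof.
  unfold perimeter.
  rewrite (Cmod_half (mid p q - p)%C q p) by (unfold mid; ring).
  rewrite (Cmod_half (p - mid p r)%C p r) by (unfold mid; ring).
  rewrite (Cmod_half (mid p r - mid p q)%C r q) by (unfold mid; ring). lra.
Qed.

Lemma perimeter_rot (p q r : C) : perimeter q r p = perimeter p q r.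
Proof. unfold perimeter. lra. Qed.

Lemma perimeter_medial (p q r : C) : perimeter (mid p q) (mid q r) (mid r p) = perimeter p q r / 2.
Proof.
  unfold perimeter.
  rewrite (Cmod_half (mid q r - mid p q)%C r p) by (apply injective_projections; simpl; field).
  rewrite (Cmod_half (mid r p - mid q r)%C p q) by (apply injective_projections; simpl; field).
  rewrite (Cmod_half (mid p q - mid r p)%C q r) by (apply injective_projections; simpl; field).
  rewrite (Cmod_minus_sym r p), (Cmod_minus_sym p q), (Cmod_minus_sym q r). lra.
Qed.

(** * Goursat's theorem for triangles *)

(** The error bound is the tail of the geometric series. It serves both the shrinking triangles of
    Goursat's theorem and the iterates of a contraction. *)
Lemma geometric_limit (u : nat -> C) (K q : R) : 0 <= q < 1 -> 0 <= K ->
  (forall n, Cmod (u (S n) - u n)%C <= K * q ^ n) ->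
  exists X, forall n, Cmod (u n - X)%C <= K / (1 - q) * q ^ n.
Proof.
  intros Hq HK Hu.
  assert (HK' : 0 <= K / (1 - q)) by (apply Rle_mult_inv_pos; lra).
  assert (Hqn : forall n, 0 <= q ^ n) by (intros; apply pow_le; lra).
  assert (A : forall n k, Cmod (u (n + k)%nat - u n)%C <= K / (1 - q) * q ^ n * (1 - q ^ k)).
  { intros n k. induction k as [|k IH].
    - rewrite Nat.add_0_r. replace (u n - u n)%C with (RtoC 0) by ring. rewrite Cmod_0. simpl. lra.
    - rewrite Nat.add_succ_r. eapply Rle_trans; [apply (Cmod_dist_triangle _ (u (n + k)%nat))|].
      eapply Rle_trans; [apply Rplus_le_compat; [apply Hu|apply IH]|].
      apply Req_le. rewrite pow_add. simpl. field. lra. }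
  assert (B : forall n k, Cmod (u (n + k)%nat - u n)%C <= K / (1 - q) * q ^ n).
  { intros n k. eapply Rle_trans; [apply A|].
    pose proof (Rmult_le_pos _ _ (Rmult_le_pos _ _ HK' (Hqn n)) (Hqn k)). lra. }
  assert (Sm : forall eps, 0 < eps -> exists N, forall n, (N <= n)%nat -> K / (1 - q) * q ^ n < eps).
  { intros eps Heps. destruct (pow_lt_1_zero q ltac:(rewrite Rabs_pos_eq; lra) (eps / (K / (1 - q) + 1))) as [N HN].
    - apply Rdiv_lt_0_compat; lra.
    - exists N. intros n Hn. specialize (HN n Hn). rewrite Rabs_pos_eq in HN by apply Hqn.
      apply (Rmult_lt_compat_l (K / (1 - q) + 1)) in HN; [|lra].
      replace ((K / (1 - q) + 1) * (eps / (K / (1 - q) + 1))) with eps in HN by (field; lra).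
      pose proof (Hqn n). lra. }
  (* Completeness is that of R, applied to both coordinates; all that matters about a coordinate is
     that it does not increase distances. *)
  assert (Cau : forall pr : C -> R, (forall x y, Rabs (pr x - pr y) <= Cmod (x - y)%C) ->
            Cauchy_crit (fun n => pr (u n))).
  { intros pr Hpr eps Heps. destruct (Sm (eps / 2)) as [N HN]; [lra|]. exists N.
    intros n m Hn Hm. unfold Rdist.
    eapply Rle_lt_trans; [apply Hpr|].
    pose proof (B N (n - N)%nat) as B1. pose proof (B N (m - N)%nat) as B2.
    replace (N + (n - N))%nat with n in B1 by lia. replace (N + (m - N))%nat with m in B2 by lia.
    specialize (HN N (le_n N)). rewrite Cmod_minus_sym in B2.
    pose proof (Cmod_dist_triangle (u n) (u N) (u m)). lra. }
  destruct (Rcomplete.R_complete _ (Cau fst ltac:(intros x y; exact (re_le_Cmod (x - y)%C)))) as [a Ha].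
  destruct (Rcomplete.R_complete _ (Cau snd ltac:(intros x y; exact (im_le_Cmod (x - y)%C)))) as [b Hb].
  exists (a, b). intros n. apply Rle_plus_epsilon. intros eps Heps.
  destruct (Ha (eps / 2)) as [N1 H1]; [lra|]. destruct (Hb (eps / 2)) as [N2 H2]; [lra|].
  set (k := (N1 + N2)%nat).
  specialize (H1 (n + k)%nat ltac:(unfold k; lia)). specialize (H2 (n + k)%nat ltac:(unfold k; lia)).
  unfold Rdist in H1, H2. specialize (B n k). rewrite Cmod_minus_sym in B.
  pose proof (Cmod_dist_triangle (u n) (u (n + k)%nat) (a, b)) as T.
  pose proof (Cmod_le_Re_Im (u (n + k)%nat - (a, b))%C) as T2.
  change (Re (u (n + k)%nat - (a, b))%C) with (fst (u (n + k)%nat) - a) in T2.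
  change (Im (u (n + k)%nat - (a, b))%C) with (snd (u (n + k)%nat) - b) in T2. lra.
Qed.

Lemma holo_linear (a b X : C) : holo (fun w => a + b * (w - X))%C (fun _ => b).
Proof.
  intros z _. eapply cdiff_eq.
  - apply cdiff_plus; [apply cdiff_const|]. apply cdiff_scal, cdiff_plus; [apply cdiff_id|apply cdiff_const].
  - ring.
Qed.

(** Affine functions thus integrate to 0 over triangles, and subtracting the affine part of an
    expansion at [X] is free. *)
Lemma holo_linear_primitive (a b X : C) :
  holo (fun w => a * w + b * / 2 * ((w - X) * (w - X)))%C (fun w => a + b * (w - X))%C.
Proof.
  intros z _. eapply cdiff_eq.
  - apply cdiff_plus; [apply cdiff_scal, cdiff_id|]. apply cdiff_scal.
    apply cdiff_mult; (apply cdiff_plus; [apply cdiff_id|apply cdiff_const]).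
  - cbv beta. field. 
Qed.

Section Goursat.
Variables (f f' : C -> C) (Hf : holo f f').

(** Without its affine part at [X], [f] is at most eps/3 times the distance to [X]. With perimeter P
    the first vertex is within 2P of [X], the sum of displacements P, P/2, P/4, ... of the nested
    triangles; hence the whole triangle is within 3P, and its boundary has length P. *)
Lemma goursat_local (X : C) : unit_disc X -> forall eps, 0 < eps -> exists del, 0 < del /\
  forall p q r, unit_disc p -> unit_disc q -> unit_disc r -> 3 * perimeter p q r < del ->
    Cmod (p - X)%C <= 2 * perimeter p q r ->
    Cmod (tri_int f p q r) <= eps * (perimeter p q r) ^ 2.
Proof.
  intros HX eps Heps. destruct (Hf X HX (eps / 3)) as [del [Hd Hh]]; [lra|].
  exists del. split; [exact Hd|]. intros p q r Hp Hq Hr Hper HpX.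
  set (P := perimeter p q r) in *.
  set (g := fun w => (f X + f' X * (w - X))%C).
  assert (Hg : holo g (fun _ => f' X)) by apply holo_linear.
  pose proof (holo_linear_primitive (f X) (f' X) X) as HG. fold g in HG.
  pose proof (holo_minus _ _ _ _ Hf Hg) as Hfg.
  assert (E : tri_int f p q r = tri_int (fun w => f w - g w)%C p q r).
  { unfold tri_int. rewrite !(seg_int_minus f f' g _ _ _ Hf Hg) by trivial.
    rewrite !(seg_int_primitive g _ Hg _ _ _ HG) by trivial. ring. }
  rewrite E. clear E.
  assert (Pq : Cmod (q - X)%C <= 3 * P).
  { pose proof (Cmod_dist_triangle q p X). pose proof (Cmod_ge_0 (r - q)%C). pose proof (Cmod_ge_0 (p - r)%C).
    unfold P, perimeter in *. lra. }
  assert (Pr : Cmod (r - X)%C <= 3 * P).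
  { pose proof (Cmod_dist_triangle r p X). rewrite (Cmod_minus_sym r p) in H.
    pose proof (Cmod_ge_0 (r - q)%C). pose proof (Cmod_ge_0 (q - p)%C).
    unfold P, perimeter in *. lra. }
  assert (PP : 0 <= P).
  { pose proof (Cmod_ge_0 (r - q)%C). pose proof (Cmod_ge_0 (p - r)%C). pose proof (Cmod_ge_0 (q - p)%C).
    unfold P, perimeter in *. lra. }
  assert (Pp : Cmod (p - X)%C <= 3 * P) by lra.
  assert (Seg : forall a b, unit_disc a -> unit_disc b -> Cmod (a - X)%C <= 3 * P -> Cmod (b - X)%C <= 3 * P ->
     Cmod (seg_int (fun w => f w - g w)%C a b) <= eps * P * Cmod (b - a)%C).
  { intros a b Ha Hb Ha' Hb'. apply (seg_int_bound _ _ Hfg); trivial.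
    intros t Ht. set (w := (a + t * (b - a))%C).
    assert (Hw : Cmod (w - X)%C <= 3 * P).
    { replace (w - X)%C with ((a - X) + t * ((b - X) - (a - X)))%C by (unfold w; ring).
      now apply Cmod_convex. }
    specialize (Hh (w - X)%C ltac:(lra)). cbv beta in Hh.
    replace (X + (w - X))%C with w in Hh by ring.
    replace (f w - g w)%C with (f w - f X - f' X * (w - X))%C by (unfold g; ring).
    eapply Rle_trans; [exact Hh|]. replace (eps * P) with (eps / 3 * (3 * P)) by field.
    apply Rmult_le_compat_l; lra. }
  pose proof (Seg p q Hp Hq Pp Pq) as S1. pose proof (Seg q r Hq Hr Pq Pr) as S2.
  pose proof (Seg r p Hr Hp Pr Pp) as S3.
  unfold tri_int. eapply Rle_trans; [apply Cmod_triangle|].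
  eapply Rle_trans; [apply Rplus_le_compat_r, Cmod_triangle|].
  assert (E : eps * P * P = eps * P * (Cmod (q - p)%C + Cmod (r - q)%C + Cmod (p - r)%C)) by reflexivity.
  simpl. lra.
Qed.

Definition tri : Type := C * C * C.
Definition tri_per (x : tri) : R := perimeter (fst (fst x)) (snd (fst x)) (snd x).
(** The bound [rho] on the vertices keeps the limit point inside the open disc. Halving divides the
    squared perimeter by 4, so one of the four parts of a bad triangle is bad for the same [eps]. *)
Definition tri_bad (rho eps : R) (x : tri) : Prop :=
  Cmod (fst (fst x)) <= rho /\ Cmod (snd (fst x)) <= rho /\ Cmod (snd x) <= rho /\
  eps * tri_per x ^ 2 < Cmod (tri_int f (fst (fst x)) (snd (fst x)) (snd x)).

Lemma Cmod_mid_le (p q : C) (rho : R) : Cmod p <= rho -> Cmod q <= rho -> Cmod (mid p q) <= rho.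
Proof. intros. apply Cmod_convex; trivial; lra. Qed.

Lemma Cmod_mid_dist (p q : C) : Cmod (mid p q - p)%C = Cmod (q - p)%C / 2.
Proof. apply Cmod_half. unfold mid. ring. Qed.

Lemma tri_bad_child (rho eps : R) (x : tri) : rho < 1 -> tri_bad rho eps x ->
  exists y, tri_bad rho eps y /\ tri_per y = tri_per x / 2 /\
    Cmod (fst (fst y) - fst (fst x))%C <= tri_per x.
Proof.
  destruct x as [[p q] r]. unfold tri_bad, tri_per. simpl. intros Hrho [Hp [Hq [Hr Hbad]]].
  assert (U : forall z, Cmod z <= rho -> unit_disc z) by (intros z Hz; unfold unit_disc; lra).
  pose proof (tri_int_split f f' p q r Hf (U _ Hp) (U _ Hq) (U _ Hr)) as E.
  set (P := perimeter p q r) in *.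
  pose proof (Cmod_ge_0 (q - p)%C) as N1. pose proof (Cmod_ge_0 (r - q)%C) as N2.
  pose proof (Cmod_ge_0 (p - r)%C) as N3.
  assert (EP : P = Cmod (q - p)%C + Cmod (r - q)%C + Cmod (p - r)%C) by reflexivity.
  pose proof (Cmod_mid_le p q rho Hp Hq) as Mpq. pose proof (Cmod_mid_le q r rho Hq Hr) as Mqr.
  pose proof (Cmod_mid_le r p rho Hr Hp) as Mrp.
  pose proof (Cmod_mid_le q p rho Hq Hp) as Mqp. pose proof (Cmod_mid_le r q rho Hr Hq) as Mrq.
  pose proof (Cmod_mid_le p r rho Hp Hr) as Mpr.
  assert (P1 : perimeter p (mid p q) (mid p r) = P / 2) by apply perimeter_corner.
  assert (P2 : perimeter q (mid q r) (mid q p) = P / 2).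
  { rewrite perimeter_corner. unfold P. now rewrite perimeter_rot. }
  assert (P3 : perimeter r (mid r p) (mid r q) = P / 2).
  { rewrite perimeter_corner. unfold P. now rewrite (perimeter_rot q r p), (perimeter_rot p q r). }
  assert (P4 : perimeter (mid p q) (mid q r) (mid r p) = P / 2) by apply perimeter_medial.
  set (T1 := tri_int f p (mid p q) (mid p r)) in *. set (T2 := tri_int f q (mid q r) (mid q p)) in *.
  set (T3 := tri_int f r (mid r p) (mid r q)) in *. set (T4 := tri_int f (mid p q) (mid q r) (mid r p)) in *.
  assert (TT : Cmod (tri_int f p q r) <= Cmod T1 + Cmod T2 + Cmod T3 + Cmod T4).
  { rewrite E. eapply Rle_trans; [apply Cmod_triangle|]. apply Rplus_le_compat_r.
    eapply Rle_trans; [apply Cmod_triangle|]. apply Rplus_le_compat_r. apply Cmod_triangle. }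
  assert (Q : 4 * (eps * (P / 2) ^ 2) = eps * P ^ 2) by field.
  destruct (Rlt_dec (eps * (P / 2) ^ 2) (Cmod T1)) as [L|L1].
  { exists (p, mid p q, mid p r). simpl. rewrite P1. repeat split; trivial.
    replace (p - p)%C with (RtoC 0) by ring. rewrite Cmod_0. lra. }
  destruct (Rlt_dec (eps * (P / 2) ^ 2) (Cmod T2)) as [L|L2].
  { exists (q, mid q r, mid q p). simpl. rewrite P2. repeat split; trivial. lra. }
  destruct (Rlt_dec (eps * (P / 2) ^ 2) (Cmod T3)) as [L|L3].
  { exists (r, mid r p, mid r q). simpl. rewrite P3. repeat split; trivial.
    rewrite Cmod_minus_sym. lra. }
  exists (mid p q, mid q r, mid r p). simpl. rewrite P4. repeat split; trivial.
  - fold T4. lra.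
  - rewrite Cmod_mid_dist. lra.
Qed.

Lemma goursat (p q r : C) : unit_disc p -> unit_disc q -> unit_disc r -> tri_int f p q r = 0%C.
Proof.
  intros Hp Hq Hr. apply NNPP. intros Hne. apply Cmod_gt_0 in Hne.
  set (rho := Rmax (Cmod p) (Rmax (Cmod q) (Cmod r))).
  assert (Hrho : rho < 1) by (repeat apply Rmax_lub_lt; assumption).
  (* Small enough for the initial triangle to be bad: the [+ 1] admits a degenerate perimeter 0, and
     the factor 1/2 makes the inequality strict. *)
  set (eps := Cmod (tri_int f p q r) / (perimeter p q r ^ 2 + 1) / 2).
  pose proof (pow2_ge_0 (perimeter p q r)) as PS.
  assert (Heps : 0 < eps) by (unfold eps; repeat apply Rdiv_lt_0_compat; lra).
  (* Badness is packed into the type, so that the choice of a bad part can be iterated. *)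
  set (Bad := {x : tri | tri_bad rho eps x}).
  assert (step : forall x : Bad, {y : Bad | tri_per (proj1_sig y) = tri_per (proj1_sig x) / 2 /\
    Cmod (fst (fst (proj1_sig y)) - fst (fst (proj1_sig x)))%C <= tri_per (proj1_sig x)}).
  { intros [x Hx]. apply constructive_indefinite_description.
    destruct (tri_bad_child rho eps x Hrho Hx) as [y [Hy Hxy]]. now exists (exist _ y Hy). }
  assert (H0 : tri_bad rho eps (p, q, r)).
  { unfold tri_bad, tri_per. simpl. repeat split.
    - apply Rmax_l.
    - eapply Rle_trans; [apply Rmax_l|apply Rmax_r].
    - eapply Rle_trans; [apply Rmax_r|apply Rmax_r].
    - unfold eps. set (T := Cmod (tri_int f p q r)) in *. set (S := perimeter p q r) in *.
      replace (T / (S ^ 2 + 1) / 2 * (S * (S * 1))) with (T * (S ^ 2 / (S ^ 2 + 1)) / 2) by (field; lra).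
      assert (S ^ 2 / (S ^ 2 + 1) <= 1) by (apply Rle_div_l; lra).
      assert (T * (S ^ 2 / (S ^ 2 + 1)) <= T * 1) by (apply Rmult_le_compat_l; lra). lra. }
  set (s := fix s (n : nat) : Bad := match n with O => exist _ _ H0 | S n => proj1_sig (step (s n)) end).
  assert (Hs : forall n, tri_per (proj1_sig (s (S n))) = tri_per (proj1_sig (s n)) / 2 /\
    Cmod (fst (fst (proj1_sig (s (S n)))) - fst (fst (proj1_sig (s n))))%C <= tri_per (proj1_sig (s n))).
  { intros n. simpl. exact (proj2_sig (step (s n))). }
  set (P := perimeter p q r) in *.
  assert (Hper : forall n, tri_per (proj1_sig (s n)) = P * (/ 2) ^ n).
  { induction n as [|n IH]. simpl. unfold tri_per. simpl. fold P. ring.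
    destruct (Hs n) as [-> _]. rewrite IH. simpl. field. }
  assert (HP : 0 <= P).
  { pose proof (Cmod_ge_0 (r - q)%C). pose proof (Cmod_ge_0 (p - r)%C). pose proof (Cmod_ge_0 (q - p)%C).
    unfold P, perimeter in *. lra. }
  destruct (geometric_limit (fun n => fst (fst (proj1_sig (s n)))) P (/ 2)) as [X HX]; [lra|exact HP| |].
  { intros n. rewrite <- Hper. apply Hs. }
  assert (HX' : unit_disc X).
  { apply Rle_lt_trans with rho; [|exact Hrho]. apply Rle_plus_epsilon. intros e He.
    destruct (pow_lt_1_zero (/ 2) ltac:(rewrite Rabs_pos_eq; lra) (e / (2 * P + 1))) as [N HN].
    { apply Rdiv_lt_0_compat; lra. }
    specialize (HN N (le_n N)). rewrite Rabs_pos_eq in HN by (apply pow_le; lra).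
    specialize (HX N). cbv beta in HX.
    assert (Q : (2 * P + 1) * (/ 2) ^ N < e).
    { apply (Rmult_lt_compat_l (2 * P + 1)) in HN; [|lra].
      replace ((2 * P + 1) * (e / (2 * P + 1))) with e in HN by (field; lra). exact HN. }
    assert (0 <= (/ 2) ^ N) by (apply pow_le; lra).
    replace (P / (1 - / 2)) with (2 * P) in HX by field.
    destruct (proj2_sig (s N)) as [Hb _].
    pose proof (Cmod_le_plus X (X - fst (fst (proj1_sig (s N)))) (fst (fst (proj1_sig (s N)))) ltac:(ring)) as HH.
    rewrite Cmod_minus_sym in HH. lra. }
  destruct (goursat_local X HX' eps Heps) as [del [Hd Hloc]].
  destruct (pow_lt_1_zero (/ 2) ltac:(rewrite Rabs_pos_eq; lra) (del / (3 * P + 1))) as [N HN].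
  { apply Rdiv_lt_0_compat; lra. }
  specialize (HN N (le_n N)). rewrite Rabs_pos_eq in HN by (apply pow_le; lra).
  specialize (HX N). cbv beta in HX.
  assert (Q : (3 * P + 1) * (/ 2) ^ N < del).
  { apply (Rmult_lt_compat_l (3 * P + 1)) in HN; [|lra].
    replace ((3 * P + 1) * (del / (3 * P + 1))) with del in HN by (field; lra). exact HN. }
  assert (Q0 : 0 <= (/ 2) ^ N) by (apply pow_le; lra).
  replace (P / (1 - / 2)) with (2 * P) in HX by field.
  specialize (Hper N). destruct (s N) as [[[a b] c] [Ha [Hb [Hc Hbad]]]]. simpl in *.
  unfold tri_per in *. simpl in *.
  specialize (Hloc a b c ltac:(unfold unit_disc; lra) ltac:(unfold unit_disc; lra) ltac:(unfold unit_disc; lra)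
    ltac:(rewrite Hper; lra) ltac:(rewrite Hper; lra)). simpl in Hloc. lra.
Qed.

End Goursat.

(** * Primitives and Cauchy integrals *)

Lemma cdiff_unique (f : C -> C) (z l m : C) : cdiff f z l -> cdiff f z m -> l = m.
Proof.
  intros H1 H2. apply cdiff_is_derive, is_C_derive_unique in H1.
  apply cdiff_is_derive, is_C_derive_unique in H2. congruence.
Qed.

Lemma unit_disc_0 : unit_disc 0%C.
Proof. unfold unit_disc. rewrite Cmod_0. lra. Qed.

(** Goursat's theorem for the triangle 0, [z], [z + h] turns the increment into an integral over the
    short segment from [z] to [z + h], where [f] is close to [f z]. *)
Lemma holo_primitive (f f' : C -> C) : holo f f' -> holo (seg_int f 0%C) f.
Proof.
  intros Hf z Hz eps Heps.
  destruct (cdiff_continuous _ _ _ (Hf z Hz) eps Heps) as [d [Hd Hc]].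
  unfold unit_disc in Hz.
  exists (Rmin d (1 - Cmod z)). split; [apply Rmin_glb_lt; lra|].
  intros h Hh. apply Rmin_Rgt in Hh. destruct Hh as [H1 H2].
  assert (Hzh : unit_disc (z + h)%C) by (unfold unit_disc; pose proof (Cmod_triangle z h); lra).
  pose proof (goursat f f' Hf 0%C z (z + h)%C unit_disc_0 Hz Hzh) as G. unfold tri_int in G.
  rewrite (seg_int_swap f f' Hf 0%C (z + h)%C unit_disc_0 Hzh) in G.
  replace (seg_int f 0 (z + h) - seg_int f 0 z - f z * h)%C
    with (seg_int f z (z + h) - seg_int (fun _ => f z) z (z + h))%C.
  - rewrite <- (seg_int_minus _ _ _ _ _ _ Hf (holo_const (f z))) by trivial.
    replace (Cmod h) with (Cmod (z + h - z)%C) by (f_equal; ring).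
    apply (seg_int_bound _ _ (holo_minus _ _ _ _ Hf (holo_const (f z)))); trivial.
    intros t Ht. apply Rlt_le, Hc.
    replace (z + t * (z + h - z) - z)%C with (t * h)%C by ring.
    rewrite Cmod_mult, Cmod_R, Rabs_pos_eq by lra. pose proof (Cmod_ge_0 h). nra.
  - rewrite (seg_int_primitive _ _ (holo_const (f z)) (fun w => f z * w)%C); trivial.
    + transitivity (seg_int f 0 z + seg_int f z (z + h) + - seg_int f 0 (z + h)
        + (seg_int f 0 (z + h) - seg_int f 0 z - f z * h))%C; [ring|]. rewrite G. ring.
    + intros w _. eapply cdiff_eq; [apply cdiff_scal, cdiff_id|ring].
Qed.

(** Integrating the first-order expansion of [f] over the segment gives one more order for [F],
    without continuity of [f']. *)
Lemma taylor2 (F f f' : C -> C) (z : C) : holo F f -> holo f f' -> unit_disc z ->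
  forall eps, 0 < eps -> exists del, 0 < del /\ forall h, Cmod h < del ->
    Cmod (F (z + h) - F z - f z * h - f' z * / 2 * (h * h))%C <= eps * (Cmod h * Cmod h).
Proof.
  intros HF Hf Hz eps Heps. destruct (Hf z Hz eps Heps) as [d [Hd Hc]].
  pose proof Hz as Hz'. unfold unit_disc in Hz'.
  exists (Rmin d (1 - Cmod z)). split; [apply Rmin_glb_lt; lra|].
  intros h Hh. apply Rmin_Rgt in Hh. destruct Hh as [H1 H2].
  assert (Hzh : unit_disc (z + h)%C) by (unfold unit_disc; pose proof (Cmod_triangle z h); lra).
  pose proof (seg_int_primitive f f' Hf F z (z + h)%C HF Hz Hzh) as E1.
  pose proof (seg_int_primitive _ _ (holo_linear (f z) (f' z) z) _ z (z + h)%C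
     (holo_linear_primitive (f z) (f' z) z) Hz Hzh) as E2.
  pose proof (seg_int_minus _ _ _ _ z (z + h)%C Hf (holo_linear (f z) (f' z) z) Hz Hzh) as E3.
  rewrite E1, E2 in E3.
  match type of E3 with ?a = ?b =>
    replace (F (z + h) - F z - f z * h - f' z * / 2 * (h * h))%C with b by ring end.
  rewrite <- E3.
  replace (eps * (Cmod h * Cmod h)) with (eps * Cmod h * Cmod (z + h - z)%C)
    by (replace (z + h - z)%C with h by ring; ring).
  apply (seg_int_bound _ _ (holo_minus _ _ _ _ Hf (holo_linear (f z) (f' z) z))); trivial.
  intros t Ht. replace (z + t * (z + h - z))%C with (z + t * h)%C by ring.
  assert (Ht' : Cmod (t * h)%C <= Cmod h).
  { rewrite Cmod_mult, Cmod_R, Rabs_pos_eq by lra. pose proof (Cmod_ge_0 h). nra. }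
  specialize (Hc (t * h)%C ltac:(lra)). cbv beta in Hc.
  replace (f (z + t * h) - (f z + f' z * (z + t * h - z)))%C with (f (z + t * h) - f z - f' z * (t * h))%C by ring.
  eapply Rle_trans; [exact Hc|]. apply Rmult_le_compat_l; lra.
Qed.

Definition diff_quot (F f : C -> C) (z w : C) : C :=
  if excluded_middle_informative (w = z) then f z else ((F w - F z) * / (w - z))%C.

(** At the removable point [w = z] differentiability requires the second-order expansion of [F],
    with derivative [f' z / 2]. This is why Cauchy's formula is proved for a function [F] whose
    derivative is known to be holomorphic: the quotient is then holomorphic on the whole disc, and
    Goursat's theorem needs no exceptional point. *)
Lemma diff_quot_holo (F f f' : C -> C) (z : C) : holo F f -> holo f f' -> unit_disc z ->
  exists g', holo (diff_quot F f z) g'.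
Proof.
  intros HF Hf Hz.
  cut (forall w, exists l, unit_disc w -> cdiff (diff_quot F f z) w l).
  { intros H. destruct (choice _ H) as [g' Hg]. exists g'. exact Hg. }
  intros w. destruct (excluded_middle_informative (w = z)) as [->|Hne].
  - exists (f' z * / 2)%C. intros _ eps Heps.
    destruct (taylor2 F f f' z HF Hf Hz eps Heps) as [d [Hd Hc]].
    exists d. split; [exact Hd|]. intros h Hh. specialize (Hc h Hh).
    destruct (excluded_middle_informative (h = 0%C)) as [->|Hh0].
    { replace (z + 0)%C with z by ring.
      replace (diff_quot F f z z - diff_quot F f z z - f' z * / 2 * 0)%C with (RtoC 0) by ring.
      rewrite Cmod_0. lra. }
    unfold diff_quot. destruct (excluded_middle_informative (z + h = z)%C) as [E|_].
    { exfalso. apply Hh0. replace h with (z + h - z)%C by ring. rewrite E. ring. }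
    destruct (excluded_middle_informative (z = z)) as [_|E]; [|now elim E].
    pose proof (proj1 (Cmod_gt_0 h) Hh0) as Ph.
    replace ((F (z + h) - F z) * / (z + h - z) - f z - f' z * / 2 * h)%C
      with ((F (z + h) - F z - f z * h - f' z * / 2 * (h * h)) / h)%C.
    2:{ replace (z + h - z)%C with h by ring. field. exact Hh0. }
    rewrite Cmod_div by exact Hh0. apply Rle_div_l; [exact Ph|]. lra.
  - assert (Hwz : (w - z)%C <> 0%C).
    { intros E. apply Hne. replace w with (w - z + z)%C by ring. rewrite E. ring. }
    pose proof (proj1 (Cmod_gt_0 _) Hwz) as Pw.
    eexists. intros Hw.
    eapply cdiff_ext_loc with (r := Cmod (w - z)%C) (f := fun w => ((F w + (- F z)) * / (w + (- z)))%C).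
    + exact Pw.
    + intros v Hv. unfold diff_quot.
      destruct (excluded_middle_informative (v = z)) as [->|_]; [|reflexivity].
      rewrite Cmod_minus_sym in Hv. lra.
    + apply cdiff_mult.
      * apply cdiff_plus; [apply HF, Hw|apply cdiff_const].
      * apply (cdiff_comp Cinv (fun w => w + - z)%C); [apply cdiff_inv, Hwz|].
        apply cdiff_plus; [apply cdiff_id|apply cdiff_const].
Qed.

(** * Integrals of Cauchy type over a circle *)

Section CauchyKernel.
Variable rho : R.
Hypothesis rho_pos : 0 < rho.

Definition circ (t : R) : C := (rho * cos t, rho * sin t).

Lemma circ_rdiff (t : R) : rdiff circ t (Ci * circ t)%C.
Proof.
  eapply rdiff_eq; [apply rdiff_components with (a := rho * - sin t) (b := rho * cos t)|].
  - unfold circ. simpl. auto_derive; trivial. ring.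
  - unfold circ. simpl. auto_derive; trivial. ring.
  - apply injective_projections; simpl; ring.
Qed.

Lemma circ_Cmod (t : R) : Cmod (circ t) = rho.
Proof.
  unfold Cmod, circ. simpl.
  replace (rho * cos t * (rho * cos t * 1) + rho * sin t * (rho * sin t * 1))
    with (rho * rho * (Rsqr (sin t) + Rsqr (cos t))) by (unfold Rsqr; ring).
  rewrite sin2_cos2, Rmult_1_r. apply sqrt_square. lra.
Qed.

Lemma circ_periodic : circ (2 * PI) = circ 0.
Proof. unfold circ. now rewrite cos_2PI, sin_2PI, cos_0, sin_0. Qed.

Lemma circ_minus_Cmod (z : C) (t : R) : rho - Cmod z <= Cmod (circ t - z)%C.
Proof. pose proof (Cmod_le_plus (circ t) (circ t - z)%C z ltac:(ring)). rewrite circ_Cmod in H. lra. Qed.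

Lemma circ_minus_neq0 (z : C) (t : R) : Cmod z < rho -> (circ t - z)%C <> 0%C.
Proof. intros Hz. apply Cmod_gt_0. pose proof (circ_minus_Cmod z t). lra. Qed.

Lemma kernel_rdiff (z : C) (t : R) (n : nat) : Cmod z < rho ->
  exists v, rdiff (fun t => (/ (circ t - z)) ^ n)%C t v.
Proof.
  intros Hz. induction n as [|n [v IH]].
  - exists 0%C. exact (rdiff_const 1%C t).
  - eexists. simpl. apply rdiff_mult; [|exact IH].
    apply (rdiff_comp Cinv (fun t => circ t - z)%C); [apply cdiff_inv, circ_minus_neq0, Hz|].
    apply rdiff_plus; [apply circ_rdiff|apply rdiff_const].
Qed.

(** The density [h] is a function of the parameter and includes the factor dw/dt: with
    [h t = F (circ t) * (Ci * circ t)] this is the contour integral of F(w) / (w - z)^n. *)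
Definition cauchy_int (h : R -> C) (n : nat) (z : C) : C :=
  CInt (fun t => h t * (/ (circ t - z)) ^ n)%C 0 (2 * PI).

Lemma two_PI_pos : 0 <= 2 * PI.
Proof. pose proof PI_RGT_0. lra. Qed.

Section Kernel.
Variable h : R -> C.
Hypothesis Hh : forall t, exists v, rdiff h t v.

Lemma cauchy_int_ex (n : nat) (z : C) : Cmod z < rho ->
  ex_CInt (fun t => h t * (/ (circ t - z)) ^ n)%C 0 (2 * PI).
Proof.
  intros Hz. apply ex_CInt_rdiff; [apply two_PI_pos|]. intros t _.
  destruct (Hh t) as [v Hv]. destruct (kernel_rdiff z t n Hz) as [w Hw].
  eexists. exact (rdiff_mult _ _ _ _ _ Hv Hw).
Qed.

Lemma rdiff_bounded : exists M, 0 <= M /\ forall t, 0 <= t <= 2 * PI -> Cmod (h t) <= M.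
Proof.
  destruct (@bounded_continuity R_AbsRing C_R_NormedModule h 0 (2 * PI)) as [M HM].
  - intros t _. destruct (Hh t) as [v Hv]. exact (rdiff_continuous _ _ _ Hv).
  - assert (HM' : forall t, 0 <= t <= 2 * PI -> Cmod (h t) <= M).
    { intros t Ht. rewrite <- C_R_norm. now apply Rlt_le, HM. }
    exists M. split; [|exact HM'].
    eapply Rle_trans; [apply Cmod_ge_0|apply (HM' 0)]. pose proof two_PI_pos. lra.
Qed.
End Kernel.

End CauchyKernel.

(** For x = 1 / (w - z - k) and y = 1 / (w - z) one has x - y = k x y. The remainder constant
    depends on [B] and [n] only, hence is uniform in the point w of the circle; this permits
    differentiation under the integral. *)
Lemma pow_expansion (B : R) (n : nat) : 0 <= B -> exists c, 0 <= c /\ forall x y k : C,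
  Cmod x <= B -> Cmod y <= B -> (x - y = k * x * y)%C ->
  Cmod (x ^ n - y ^ n - INR n * y ^ (S n) * k)%C <= c * (Cmod k * Cmod k).
Proof.
  intros HB. induction n as [|n [c [Hc IH]]].
  - exists 0. split; [lra|]. intros x y k _ _ _. simpl.
    replace (1 - 1 - 0 * (y * 1) * k)%C with (RtoC 0) by ring. rewrite Cmod_0. lra.
  - exists (B * c + INR (S n) * (B * B ^ (S (S n)))).
    pose proof (pos_INR (S n)) as Pn.
    assert (PB : 0 <= B ^ (S (S n))) by (apply pow_le; lra).
    split. { apply Rplus_le_le_0_compat; [now apply Rmult_le_pos|]. apply Rmult_le_pos; [exact Pn|now apply Rmult_le_pos]. }
    intros x y k Hx Hy E. specialize (IH x y k Hx Hy E).
    rewrite S_INR, RtoC_plus.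
    replace (x ^ S n - y ^ S n - (INR n + 1) * y ^ S (S n) * k)%C
      with (x * (x ^ n - y ^ n - INR n * y ^ S n * k) + (INR n + 1) * (k * k) * (x * y ^ S (S n)))%C.
    (* The two sides differ by a multiple of [x - y - k * x * y], which vanishes by [E]. *)
    2:{ simpl. generalize (x ^ n)%C (y ^ n)%C (RtoC (INR n)). intros xn yn N.
        transitivity (x * xn - y * yn - (N + 1) * (y * (y * yn)) * k
          - yn * (1 + N * k * y + k * y) * (x - y - k * x * y))%C; [|rewrite E]; ring. }
    eapply Rle_trans; [apply Cmod_triangle|].
    rewrite !Cmod_mult, Cmod_pow, <- RtoC_plus, <- S_INR, Cmod_R, (Rabs_pos_eq _ Pn).
    pose proof (Cmod_ge_0 k) as Pk. pose proof (Cmod_ge_0 x) as Px. pose proof (Cmod_ge_0 y) as Py.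
    assert (A1 : Cmod x * Cmod (x ^ n - y ^ n - INR n * y ^ S n * k)%C <= B * (c * (Cmod k * Cmod k))).
    { apply Rmult_le_compat; trivial; apply Cmod_ge_0. }
    assert (A2 : Cmod x * Cmod y ^ S (S n) <= B * B ^ S (S n)).
    { apply Rmult_le_compat; trivial; [apply pow_le; lra|]. now apply pow_incr. }
    apply (Rmult_le_compat_l (INR (S n) * (Cmod k * Cmod k))) in A2.
    2:{ repeat apply Rmult_le_pos; trivial. }
    lra.
Qed.

Section CauchyDerivative.
Variables (rho : R) (h : R -> C).
Hypothesis rho_pos : 0 < rho.
Hypothesis Hh : forall t, exists v, rdiff h t v.

Lemma cauchy_int_cdiff (n : nat) (z : C) : Cmod z < rho ->
  cdiff (cauchy_int rho h n) z (INR n * cauchy_int rho h (S n) z)%C.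
Proof.
  intros Hz eps Heps.
  (* Half the distance from [z] to the circle: for |k| < eta both [z] and [z + k] stay at distance
     at least [eta] from it, so both kernels are bounded by [/ eta]. *)
  set (eta := (rho - Cmod z) / 2). assert (Peta : 0 < eta) by (unfold eta; lra).
  assert (PB : 0 < / eta) by now apply Rinv_0_lt_compat.
  destruct (pow_expansion (/ eta) n (Rlt_le _ _ PB)) as [c [Hc Hexp]].
  destruct (rdiff_bounded h Hh) as [M [PM HM]].
  set (K := M * c * (2 * PI)).
  assert (PK : 0 <= K) by (apply Rmult_le_pos; [now apply Rmult_le_pos|apply two_PI_pos]).
  exists (Rmin eta (eps / (K + 1))).
  split. { apply Rmin_glb_lt; [exact Peta|]. apply Rdiv_lt_0_compat; lra. }
  intros k Hk. apply Rmin_Rgt in Hk. destruct Hk as [Hk1 Hk2].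
  assert (Hzk : Cmod (z + k)%C < rho) by (pose proof (Cmod_triangle z k); unfold eta in *; lra).
  assert (E : (cauchy_int rho h n (z + k) - cauchy_int rho h n z
               - INR n * cauchy_int rho h (S n) z * k)%C
    = CInt (fun t => h t * (/ (circ rho t - (z + k))) ^ n - h t * (/ (circ rho t - z)) ^ n
             - INR n * k * (h t * (/ (circ rho t - z)) ^ S n))%C 0 (2 * PI)).
  { pose proof (cauchy_int_ex rho rho_pos h Hh n (z + k)%C Hzk) as I1.
    pose proof (cauchy_int_ex rho rho_pos h Hh n z Hz) as I2.
    pose proof (cauchy_int_ex rho rho_pos h Hh (S n) z Hz) as I3.
    rewrite CInt_minus.
    - rewrite CInt_minus by trivial. rewrite CInt_scal by trivial. unfold cauchy_int. ring.
    - apply (@ex_RInt_minus C_R_NormedModule _ _ _ _ I1 I2).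
    - apply ex_CInt_rdiff; [apply two_PI_pos|]. intros t _.
      destruct (Hh t) as [v Hv]. destruct (kernel_rdiff rho rho_pos z t (S n) Hz) as [w Hw].
      eexists. apply (rdiff_mult (fun _ => (INR n * k)%C)); [apply rdiff_const|].
      apply rdiff_mult; [exact Hv|exact Hw]. }
  rewrite E.
  assert (Bd : forall t, 0 <= t <= 2 * PI -> Cmod (h t * (/ (circ rho t - (z + k))) ^ n
      - h t * (/ (circ rho t - z)) ^ n - INR n * k * (h t * (/ (circ rho t - z)) ^ S n))%C
      <= M * c * (Cmod k * Cmod k)).
  { intros t Ht.
    pose proof (circ_minus_Cmod rho rho_pos z t) as C1.
    pose proof (circ_minus_Cmod rho rho_pos (z + k)%C t) as C2.
    pose proof (circ_minus_neq0 rho rho_pos z t Hz) as N1.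
    pose proof (circ_minus_neq0 rho rho_pos (z + k)%C t Hzk) as N2.
    set (x := (/ (circ rho t - (z + k)))%C). set (y := (/ (circ rho t - z))%C).
    replace (h t * x ^ n - h t * y ^ n - INR n * k * (h t * y ^ S n))%C
      with (h t * (x ^ n - y ^ n - INR n * y ^ S n * k))%C by ring.
    rewrite Cmod_mult, (Rmult_assoc M).
    apply Rmult_le_compat; [apply Cmod_ge_0|apply Cmod_ge_0|now apply HM|].
    pose proof (Cmod_triangle z k).
    apply Hexp.
    - unfold x. rewrite Cmod_inv by exact N2. apply Rinv_le_contravar; [exact Peta|]. unfold eta in *; lra.
    - unfold y. rewrite Cmod_inv by exact N1. apply Rinv_le_contravar; [exact Peta|]. unfold eta in *; lra.
    - unfold x, y. field. split; trivial. }
  eapply Rle_trans; [apply CInt_bound; [apply two_PI_pos| |exact Bd]|].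
  { apply ex_CInt_rdiff; [apply two_PI_pos|]. intros t _.
    destruct (Hh t) as [v Hv]. destruct (kernel_rdiff rho rho_pos z t (S n) Hz) as [w Hw].
    destruct (kernel_rdiff rho rho_pos z t n Hz) as [w1 Hw1].
    destruct (kernel_rdiff rho rho_pos (z + k)%C t n Hzk) as [w2 Hw2].
    eexists. apply rdiff_minus; [apply rdiff_minus|].
    - apply rdiff_mult; [exact Hv|exact Hw2].
    - apply rdiff_mult; [exact Hv|exact Hw1].
    - apply (rdiff_mult (fun _ => (INR n * k)%C)); [apply rdiff_const|].
      apply rdiff_mult; [exact Hv|exact Hw]. }
  pose proof (Cmod_ge_0 k) as Pk.
  replace (M * c * (Cmod k * Cmod k) * (2 * PI - 0)) with (K * Cmod k * Cmod k) by (unfold K; ring).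
  apply Rmult_le_compat_r; [exact Pk|].
  apply Rlt_le in Hk2. apply (Rmult_le_compat_l (K + 1)) in Hk2; [|lra].
  replace ((K + 1) * (eps / (K + 1))) with eps in Hk2 by (field; lra).
  assert (0 <= Cmod k) by exact Pk. lra.
Qed.

End CauchyDerivative.

(** * Cauchy's formula and the derivative of a holomorphic function *)

Section CauchyFormula.
Variable rho : R.
Hypothesis rho_pos : 0 < rho.
Notation h0 := (fun t => Ci * circ rho t)%C.

Lemma circ_Ci_rdiff (t : R) : rdiff h0 t (Ci * (Ci * circ rho t))%C.
Proof.
  eapply rdiff_eq; [apply (rdiff_mult (fun _ => Ci)); [apply rdiff_const|apply circ_rdiff]|].
  cbv beta; ring.
Qed.

(** The integrand is the derivative of -1 / (w - z) along a closed curve. Up to the factor 1 it is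
    also the derivative in [z] of the integral of order 1. *)
Lemma winding_derivative (z : C) : Cmod z < rho -> cauchy_int rho h0 2 z = 0%C.
Proof.
  intros Hz. unfold cauchy_int.
  rewrite (CInt_FTC (fun t => - (1) * / (circ rho t - z))%C).
  - rewrite circ_periodic. ring.
  - apply two_PI_pos.
  - intros t _. eapply rdiff_eq.
    + apply (rdiff_mult (fun _ => (- (1))%C)); [apply rdiff_const|].
      apply (rdiff_comp Cinv (fun t => circ rho t - z)%C); [apply cdiff_inv, circ_minus_neq0; trivial|].
      apply rdiff_plus; [apply circ_rdiff|apply rdiff_const].
    + cbv beta. simpl. field. now apply circ_minus_neq0.
  - intros t _. destruct (kernel_rdiff rho rho_pos z t 2 Hz) as [w Hw].
    eexists. exact (rdiff_mult _ _ _ _ _ (circ_Ci_rdiff t) Hw).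
Qed.

(** The integral does not change along the segment from 0 to [z], its derivative being 0, and at 0
    the integrand is the constant [Ci]. *)
Lemma winding_number (z : C) : Cmod z < rho -> cauchy_int rho h0 1 z = ((2 * PI)%R * Ci)%C.
Proof.
  intros Hz.
  assert (Ht : forall t, 0 <= t <= 1 -> Cmod (t * z)%C < rho).
  { intros t Ht. rewrite Cmod_mult, Cmod_R, Rabs_pos_eq by lra. pose proof (Cmod_ge_0 z). nra. }
  assert (Hh : forall t, exists v, rdiff h0 t v) by (intros t; eexists; apply circ_Ci_rdiff).
  assert (D : forall t, 0 <= t <= 1 -> rdiff (fun t => cauchy_int rho h0 1 (0 + t * z)%C) t 0%C).
  { intros t Hlt. eapply rdiff_eq.
    - apply (rdiff_comp (cauchy_int rho h0 1)); [|apply rdiff_affine].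
      replace (0 + t * z)%C with (t * z)%C by ring.
      apply (cauchy_int_cdiff rho h0 rho_pos Hh); auto.
    - rewrite winding_derivative by auto. ring. }
  pose proof (CInt_FTC _ (fun _ => 0%C) 0 1 ltac:(lra) D ltac:(intros t _; eexists; apply rdiff_const)) as F.
  rewrite (@RInt_const C_R_CompleteNormedModule) in F.
  cbv beta in F.
  assert (F' : RtoC 0 = (cauchy_int rho h0 1 (0 + 1%R * z) - cauchy_int rho h0 1 (0 + 0%R * z))%C).
  { rewrite <- F. apply injective_projections; simpl; unfold scal; simpl; unfold mult; simpl; ring. }
  clear F; rename F' into F.
  replace (0 + 1%R * z)%C with z in F by ring. replace (0 + 0%R * z)%C with (RtoC 0) in F by ring.
  transitivity (cauchy_int rho h0 1 0%C).
  { transitivity (cauchy_int rho h0 1 z - cauchy_int rho h0 1 0 + cauchy_int rho h0 1 0)%C; [ring|].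
    rewrite <- F. ring. }
  unfold cauchy_int.
  transitivity (CInt (fun _ => Ci) 0 (2 * PI)).
  - apply (@RInt_ext C_R_CompleteNormedModule). intros t _. simpl.
    assert (N : (circ rho t - 0)%C <> 0%C) by (apply circ_minus_neq0; [trivial|now rewrite Cmod_0]).
    assert (N' : circ rho t <> 0%C) by (intros E; apply N; rewrite E; ring).
    change (Ci * circ rho t * (/ (circ rho t - 0) * 1) = Ci)%C. field. 
    exact N'.
  - rewrite (@RInt_const C_R_CompleteNormedModule).
    apply injective_projections; simpl; unfold scal; simpl; unfold mult; simpl; ring.
Qed.

(** The difference quotient of [F] at [z] has a primitive on the disc, so its integral over the
    closed circle is 0; splitting the quotient leaves [F z] times the winding integral. *)
Lemma cauchy_formula (F f f' : C -> C) (z : C) : rho < 1 -> holo F f -> holo f f' -> Cmod z < rho ->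
  F z = (/ ((2 * PI)%R * Ci) * cauchy_int rho (fun t => F (circ rho t) * (Ci * circ rho t)) 1 z)%C.
Proof.
  intros Hrho HF Hf Hz.
  assert (Hu : unit_disc z) by (unfold unit_disc; lra).
  assert (Hc : forall t, unit_disc (circ rho t)) by (intros t; unfold unit_disc; rewrite circ_Cmod by trivial; lra).
  destruct (diff_quot_holo F f f' z HF Hf Hu) as [g' Hg].
  pose proof (holo_primitive _ _ Hg) as HG. set (G := seg_int (diff_quot F f z) 0%C) in HG.
  assert (Z : CInt (fun t => diff_quot F f z (circ rho t) * (Ci * circ rho t))%C 0 (2 * PI) = RtoC 0).
  { rewrite (CInt_FTC (fun t => G (circ rho t))).
    - rewrite circ_periodic. apply Cplus_opp_r.
    - apply two_PI_pos.
    - intros t _. apply (rdiff_comp G); [apply HG, Hc|apply circ_rdiff].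
    - intros t _. eexists. apply rdiff_mult; [|apply circ_Ci_rdiff].
      apply (rdiff_comp (diff_quot F f z)); [apply Hg, Hc|apply circ_rdiff]. }
  assert (HFr : forall t, exists v, rdiff (fun t => F (circ rho t) * (Ci * circ rho t))%C t v).
  { intros t. eexists. apply rdiff_mult; [|apply circ_Ci_rdiff].
    apply (rdiff_comp F); [apply HF, Hc|apply circ_rdiff]. }
  assert (E : CInt (fun t => diff_quot F f z (circ rho t) * (Ci * circ rho t))%C 0 (2 * PI)
    = (cauchy_int rho (fun t => F (circ rho t) * (Ci * circ rho t)) 1 z
       - F z * cauchy_int rho h0 1 z)%C).
  { unfold cauchy_int. rewrite <- CInt_scal, <- CInt_minus.
    - apply (@RInt_ext C_R_CompleteNormedModule). intros t _.
      unfold diff_quot. destruct (excluded_middle_informative (circ rho t = z)) as [Eq|_].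
      + exfalso. apply (circ_minus_neq0 rho rho_pos z t Hz). rewrite Eq. ring.
      + simpl.
        change ((F (circ rho t) - F z) * / (circ rho t - z) * (Ci * circ rho t) =
          F (circ rho t) * (Ci * circ rho t) * (/ (circ rho t - z) * 1)
          - F z * (Ci * circ rho t * (/ (circ rho t - z) * 1)))%C. ring.
    - apply (cauchy_int_ex rho rho_pos (fun t => F (circ rho t) * (Ci * circ rho t))%C); trivial.
    - apply ex_CInt_rdiff; [apply two_PI_pos|]. intros t _.
      destruct (kernel_rdiff rho rho_pos z t 1 Hz) as [w Hw].
      eexists. apply (rdiff_mult (fun _ => F z)); [apply rdiff_const|].
      exact (rdiff_mult _ _ _ _ _ (circ_Ci_rdiff t) Hw).
    - apply (cauchy_int_ex rho rho_pos h0); trivial. intros t; eexists; apply circ_Ci_rdiff. }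
  rewrite Z, winding_number in E by trivial.
  assert (N : ((2 * PI)%R * Ci)%C <> 0%C).
  { intros H. apply (f_equal snd) in H. simpl in H. pose proof PI_RGT_0. lra. }
  set (J := cauchy_int rho _ 1 z) in *. set (c := ((2 * PI)%R * Ci)%C) in *.
  replace J with (F z * c)%C; [field; exact N|].
  transitivity (F z * c + 0)%C; [ring|]. rewrite E. ring.
Qed.

End CauchyFormula.

(** Cauchy's formula for a primitive [F] of [f] is differentiated under the integral: near [z] the
    functions [F], [f], [f'] are Cauchy integrals of orders 1, 2, 3 with the same density, and the
    last is differentiable again. *)
Lemma holo_derivative (f f' : C -> C) : holo f f' -> exists f'', holo f' f''.
Proof.
  intros Hf. cut (forall z, exists l, unit_disc z -> cdiff f' z l).
  { intros H. destruct (choice _ H) as [g' Hg]. exists g'. exact Hg. }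
  intros z. destruct (classic (unit_disc z)) as [Hz|Hz]; [|exists 0%C; intros; contradiction].
  pose proof (holo_primitive _ _ Hf) as HF. set (F := seg_int f 0%C) in HF. unfold unit_disc in Hz.
  set (rho := (1 + Cmod z) / 2). pose proof (Cmod_ge_0 z) as Pz.
  assert (Hr : 0 < rho) by (unfold rho; lra). assert (Hr1 : rho < 1) by (unfold rho; lra).
  assert (Hzr : Cmod z < rho) by (unfold rho; lra).
  set (h := fun t => (F (circ rho t) * (Ci * circ rho t))%C).
  assert (Hh : forall t, exists v, rdiff h t v).
  { intros t. eexists. apply rdiff_mult; [|apply circ_Ci_rdiff].
    apply (rdiff_comp F); [|apply circ_rdiff]. apply HF. unfold unit_disc. rewrite circ_Cmod; trivial. }
  set (c := (/ ((2 * PI)%R * Ci))%C).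
  assert (near : forall w, Cmod w < rho -> forall v, Cmod (v - w)%C < rho - Cmod w -> Cmod v < rho).
  { intros w Hw v Hv. pose proof (Cmod_le_plus v (v - w)%C w ltac:(ring)). lra. }
  assert (E0 : forall w, Cmod w < rho -> F w = (c * cauchy_int rho h 1 w)%C).
  { intros w Hw. exact (cauchy_formula rho Hr F f f' w Hr1 HF Hf Hw). }
  assert (E1 : forall w, Cmod w < rho -> f w = (c * (INR 1 * cauchy_int rho h 2 w))%C).
  { intros w Hw. apply (cdiff_unique F w); [apply HF; unfold unit_disc; lra|].
    eapply cdiff_ext_loc with (r := rho - Cmod w) (f := fun w => (c * cauchy_int rho h 1 w)%C); [lra| |].
    - intros v Hv. symmetry. apply E0. eapply near; eauto.
    - apply cdiff_scal, (cauchy_int_cdiff rho h Hr Hh); trivial. }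
  assert (E2 : forall w, Cmod w < rho -> f' w = (c * (INR 1 * (INR 2 * cauchy_int rho h 3 w)))%C).
  { intros w Hw. apply (cdiff_unique f w); [apply Hf; unfold unit_disc; lra|].
    eapply cdiff_ext_loc with (r := rho - Cmod w) (f := fun w => (c * (INR 1 * cauchy_int rho h 2 w))%C); [lra| |].
    - intros v Hv. symmetry. apply E1. eapply near; eauto.
    - apply cdiff_scal, cdiff_scal, (cauchy_int_cdiff rho h Hr Hh); trivial. }
  eexists. intros _.
  eapply cdiff_ext_loc with (r := rho - Cmod z)
    (f := fun w => (c * (INR 1 * (INR 2 * cauchy_int rho h 3 w)))%C); [lra| |].
  - intros v Hv. symmetry. apply E2. eapply near; eauto.
  - apply cdiff_scal, cdiff_scal, cdiff_scal, (cauchy_int_cdiff rho h Hr Hh); trivial.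
Qed.

Lemma holo_C_derive (f : C -> C) : analytic_on_disc f -> holo f (C_derive f).
Proof.
  intros H z Hz. apply cdiff_is_derive, C_derive_correct; [exact z|]. now apply H.
Qed.

Lemma analytic_C_derive (f : C -> C) : analytic_on_disc f -> analytic_on_disc (C_derive f).
Proof.
  intros H. destruct (holo_derivative _ _ (holo_C_derive f H)) as [g Hg].
  intros z Hz. exists (g z). now apply cdiff_is_derive, Hg.
Qed.

(** * The bound |t'| < Re s' *)

Lemma derive_at_right_min (u : R -> R) (t l : R) :
  0 < t -> is_derive u t l -> (forall s, 0 <= s <= t -> u t <= u s) -> l <= 0.
Proof.
  intros Ht Hu Hmin. apply Rnot_lt_le. intros Hl.
  apply is_derive_Reals in Hu. destruct (Hu (l / 2) ltac:(lra)) as [[d Hd] H]. simpl in H.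
  set (k := Rmin (d / 2) t).
  assert (Hk : 0 < k) by (apply Rmin_glb_lt; lra).
  assert (Hk1 : k <= d / 2) by apply Rmin_l. assert (Hk2 : k <= t) by apply Rmin_r.
  specialize (H (- k) ltac:(lra) ltac:(rewrite Rabs_left; lra)).
  specialize (Hmin (t + - k) ltac:(lra)).
  assert (Q : (u (t + - k) - u t) / - k <= 0).
  { replace ((u (t + - k) - u t) / - k) with (- ((u (t + - k) - u t) / k)) by (field; lra).
    assert (0 <= (u (t + - k) - u t) / k) by (apply Rle_mult_inv_pos; lra). lra. }
  rewrite Rabs_left in H by lra. lra.
Qed.

(** At a minimum [t > 0] of [u t = Re h(t z)] on [0,1] one has [t u'(t) <= 0], so that
    [a u(t) >= a u(t) + b t u'(t) > 0]. *)
Lemma Re_pos_of_euler_operator (h h' : C -> C) (a b : R) : 0 < a -> 0 <= b -> holo h h' ->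
  (forall z, unit_disc z -> 0 < Re (a * h z + b * (z * h' z))%C) ->
  forall z, unit_disc z -> 0 < Re (h z).
Proof.
  intros Ha Hb Hh Hpos z Hz.
  set (u := fun t : R => Re (h (0 + t * z)%C)).
  assert (Hin : forall t, 0 <= t <= 1 -> unit_disc (0 + t * z)%C).
  { intros t Ht. unfold unit_disc in *. rewrite Cplus_0_l, Cmod_mult, Cmod_R, Rabs_pos_eq by lra.
    pose proof (Cmod_ge_0 z). nra. }
  assert (Hu : forall t, 0 <= t <= 1 -> is_derive u t (Re (h' (0 + t * z) * z)%C)).
  { intros t Ht. apply rdiff_Re, (rdiff_comp h); [now apply Hh, Hin|apply rdiff_affine]. }
  destruct (continuity_ab_min u 0 1 ltac:(lra)) as [t [Hmin Ht]].
  { intros t Ht. apply continuity_pt_filterlim, (ex_derive_continuous u). eexists. now apply Hu. }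
  assert (Pt : 0 < u t).
  { specialize (Hpos _ (Hin t Ht)).
    assert (D : t * Re (h' (0 + t * z) * z)%C <= 0).
    { destruct (Req_dec t 0) as [->|Hne]; [lra|].
      assert (Re (h' (0 + t * z) * z)%C <= 0).
      { apply (derive_at_right_min u t); [lra|now apply Hu|]. intros s Hs. apply Hmin. lra. }
      nra. }
    assert (E : Re (a * h (0 + t * z) + b * ((0 + t * z) * h' (0 + t * z)))%C
      = a * u t + b * (t * Re (h' (0 + t * z) * z)%C)).
    { unfold u. generalize (h (0 + t * z)%C) (h' (0 + t * z)%C). intros x y. unfold Re. simpl. ring. }
    rewrite E in Hpos. nra. }
  specialize (Hmin 1 ltac:(lra)). unfold u at 2 in Hmin.
  replace (0 + 1%R * z)%C with z in Hmin by ring. lra.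
Qed.

Lemma Cmod_lt_Re (p q : C) : (forall e, Cmod e = 1 -> 0 < Re (p + e * q)%C) -> Cmod q < Re p.
Proof.
  intros H. destruct (classic (q = 0%C)) as [->|Hq].
  - rewrite Cmod_0. specialize (H 1%C Cmod_1). replace (p + 1 * 0)%C with p in H by ring. exact H.
  - pose proof (proj1 (Cmod_gt_0 q) Hq) as Pq.
    assert (Nq : RtoC (Cmod q) <> 0%C) by (intros E; apply (f_equal fst) in E; simpl in E; lra).
    (* This unimodular number rotates [q] to [- Cmod q], the worst case of the hypothesis. *)
    specialize (H (- Cconj q / Cmod q)%C).
    rewrite Cmod_div, Cmod_opp, Cmod_conj, Cmod_R, Rabs_pos_eq in H by (trivial; lra).
    specialize (H ltac:(field; lra)).
    replace (- Cconj q / Cmod q * q)%C with (RtoC (- Cmod q)) in H.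
    + change (0 < Re p + - Cmod q) in H. lra.
    + rewrite RtoC_opp. transitivity (- (q * Cconj q) / Cmod q)%C; [|field; exact Nq].
      rewrite <- Cmod2_conj. simpl. rewrite Rmult_1_r, RtoC_mult. field. exact Nq.
Qed.

Lemma RH0_derivative_bound (gamma delta lambda : R) (s t : C -> C) :
  0 <= lambda -> lambda < gamma -> gamma <= delta -> in_RH0 gamma delta lambda s t ->
  forall z, unit_disc z -> Cmod (D1 t z) < Re (D1 s z).
Proof.
  intros Hl Hg Hd [[Hs [Ht _]] HL].
  pose proof (analytic_C_derive s Hs) as Hs1. pose proof (analytic_C_derive t Ht) as Ht1.
  pose proof (analytic_C_derive _ Hs1) as Hs2. pose proof (analytic_C_derive _ Ht1) as Ht2.
  set (b := (delta - gamma) / 2). assert (Hb : 0 <= b) by (unfold b; lra).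
  intros z Hz. apply Cmod_lt_Re. intros e He. revert z Hz.
  set (g := fun z => (D1 s z + e * D1 t z)%C).
  set (g1 := fun z => (D2 s z + e * D2 t z)%C).
  set (g2 := fun z => (D3 s z + e * D3 t z)%C).
  assert (Hg0 : holo g g1) by (apply holo_plus; [|apply holo_scal]; now apply holo_C_derive).
  assert (Hg1 : holo g1 g2) by (apply holo_plus; [|apply holo_scal]; now apply holo_C_derive).
  (* The two factors are removed in turn. Here [a = gamma] is positive because
     [0 <= lambda < gamma]; the product of the factors is [Lop] because [delta = gamma + 2 b], and
     [lambda >= 0] is used again to discard it from the assumed inequality. *)
  apply (Re_pos_of_euler_operator g g1 gamma b); [lra|exact Hb|exact Hg0|].
  apply (Re_pos_of_euler_operator (fun z => gamma * g z + b * (z * g1 z))%C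
    (fun z => gamma * g1 z + b * (1 * g1 z + z * g2 z))%C 1 1); [lra|lra| |].
  { apply holo_plus; apply holo_scal; [exact Hg0|].
    intros z Hz. apply (cdiff_mult (fun z => z)); [apply cdiff_id|now apply Hg1]. }
  intros z Hz. specialize (HL z Hz).
  assert (E : (1%R * (gamma * g z + b * (z * g1 z)) + 1%R * (z * (gamma * g1 z + b * (1 * g1 z + z * g2 z))))%C
    = (Lop gamma delta s z + e * Lop gamma delta t z)%C).
  { unfold Lop, g, g1, g2. fold b. replace delta with (gamma + 2 * b) by (unfold b; field).
    rewrite RtoC_plus, RtoC_mult. ring. }
  rewrite E.
  change (Re (Lop gamma delta s z + e * Lop gamma delta t z)%C)
    with (Re (Lop gamma delta s z) + Re (e * Lop gamma delta t z)%C).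
  change (Re (Lop gamma delta s z - lambda)%C) with (Re (Lop gamma delta s z) - lambda) in HL.
  pose proof (re_le_Cmod (e * Lop gamma delta t z)%C) as B. rewrite Cmod_mult, He in B.
  pose proof (Rabs_maj2 (Re (e * Lop gamma delta t z)%C)). lra.
Qed.

(** * Discs: compactness, projection and contractions *)

Definition dot (a b : C) : R := fst a * fst b + snd a * snd b.

Lemma dot_self (a : C) : dot a a = Cmod a ^ 2.
Proof. rewrite Cmod2_alt. unfold dot, Re, Im. ring. Qed.

Lemma dot_le (a b : C) : dot a b <= Cmod a * Cmod b.
Proof.
  pose proof (re_le_Cmod (Cconj a * b)%C) as H. rewrite Cmod_mult, Cmod_conj in H.
  replace (Re (Cconj a * b)%C) with (dot a b) in H by (unfold dot, Re; simpl; ring).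
  pose proof (Rle_abs (dot a b)). lra.
Qed.

Lemma dot_ge (a b : C) : - (Cmod a * Cmod b) <= dot a b.
Proof.
  pose proof (dot_le (- a)%C b) as H. rewrite Cmod_opp in H.
  replace (dot (- a) b) with (- dot a b) in H by (unfold dot; simpl; ring). lra.
Qed.

(** Compactness as a uniform choice: [d] is both the size of a neighbourhood and the bound valid on
    it, and bounds may be decreased. Lower bounds use [d] itself, upper bounds [/ d]. *)
Lemma disc_uniform (r : R) (P : C -> R -> Prop) :
  (forall z a b, P z a -> 0 < b -> b <= a -> P z b) ->
  (forall z, Cmod z <= r -> exists d, 0 < d /\
     forall w, Cmod w <= r -> Cmod (w - z)%C < d -> P w d) ->
  exists d, 0 < d /\ forall z, Cmod z <= r -> P z d.
Proof.
  intros Hmon Hloc.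
  assert (H : forall u v : R, exists d : posreal, forall w, Cmod w <= r -> Cmod (w - (u, v))%C < 2 * d -> P w d).
  { intros u v. destruct (Rle_dec (Cmod (u, v)) r) as [Hz|Hz].
    - destruct (Hloc _ Hz) as [d [Hd Hw]]. assert (Hd2 : 0 < d / 2) by lra.
      exists (mkposreal _ Hd2). simpl. intros w Hwr Hwd. apply (Hmon w d); [|lra|lra].
      apply Hw; [exact Hwr|]. lra.
    (* The covering is of the square around the disc. A centre outside the disc gets a neighbourhood
       that misses the disc, so nothing is required there. *)
    - assert (Hd2 : 0 < (Cmod (u, v) - r) / 2) by lra.
      exists (mkposreal _ Hd2). simpl. intros w Hwr Hwd. exfalso.
      pose proof (Cmod_le_plus (u, v) ((u, v) - w)%C w ltac:(apply injective_projections; simpl; ring)) as T.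
      rewrite Cmod_minus_sym in T. lra. }
  set (delta := fun u v => proj1_sig (constructive_indefinite_description _ (H u v))).
  assert (Hdelta : forall u v w, Cmod w <= r -> Cmod (w - (u, v))%C < 2 * delta u v -> P w (delta u v)).
  { intros u v. exact (proj2_sig (constructive_indefinite_description _ (H u v))). }
  destruct (compactness_value_2d (- r) r (- r) r delta) as [d Hd].
  exists d. split; [apply cond_pos|]. intros z Hz. apply NNPP. intros Hn.
  pose proof (re_le_Cmod z) as B1. pose proof (im_le_Cmod z) as B2.
  apply (Hd (fst z) (snd z)).
  - apply Rabs_le_between. unfold Re in B1. lra.
  - apply Rabs_le_between. unfold Im in B2. lra.
  - intros [u [v [_ [_ [H1 [H2 H3]]]]]]. apply Hn.
    apply (Hmon z (delta u v)); [|apply cond_pos|exact H3].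
    apply Hdelta; [exact Hz|].
    eapply Rle_lt_trans; [apply Cmod_le_Re_Im|].
    change (Rabs (fst z - u) + Rabs (snd z - v) < 2 * delta u v). lra.
Qed.

(** Without a cluster point every [z] has a neighbourhood visited by finitely many indices only. A
    uniform [d] then forbids all indices from [/ d] on to the entire disc. *)
Lemma disc_cluster_point (u : nat -> C) : (forall n, Cmod (u n) <= 1) ->
  exists z, forall eps, 0 < eps -> forall N, exists n, (N <= n)%nat /\ Cmod (u n - z)%C < eps.
Proof.
  intros Hu. apply NNPP. intros Hno.
  destruct (disc_uniform 1 (fun z d => forall n, / d <= INR n -> u n <> z)) as [d [Hd Hall]].
  - intros z a b Ha Hb Hab n Hn. apply Ha. eapply Rle_trans; [|exact Hn].
    now apply Rinv_le_contravar.
  - intros z _. 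
    assert (Hz : ~ forall eps, 0 < eps -> forall N, exists n, (N <= n)%nat /\ Cmod (u n - z)%C < eps).
    { intros Hz. apply Hno. now exists z. }
    apply not_all_ex_not in Hz. destruct Hz as [eps Hz].
    apply imply_to_and in Hz. destruct Hz as [Heps Hz].
    apply not_all_ex_not in Hz. destruct Hz as [N Hz].
    pose proof (pos_INR N) as PN.
    exists (Rmin eps (/ (INR N + 1))). split.
    { apply Rmin_glb_lt; [exact Heps|]. apply Rinv_0_lt_compat. lra. }
    intros w _ Hw n Hn E. apply Hz. exists n. split.
    + apply INR_le.
      assert (/ / (INR N + 1) <= / Rmin eps (/ (INR N + 1))).
      { apply Rinv_le_contravar; [|apply Rmin_r].
        apply Rmin_glb_lt; [exact Heps|]. apply Rinv_0_lt_compat. lra. }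
      rewrite Rinv_inv in H. lra.
    + rewrite E. eapply Rlt_le_trans; [exact Hw|apply Rmin_l].
  - destruct (INR_unbounded (/ d)) as [n Hn]. apply (Hall (u n) (Hu n) n); [lra|reflexivity].
Qed.

Definition proj_disc (r : R) (z : C) : C := if Rle_dec (Cmod z) r then z else ((r / Cmod z)%R * z)%C.

Lemma proj_disc_le (r : R) (z : C) : 0 <= r -> Cmod (proj_disc r z) <= r.
Proof.
  intros Hr. unfold proj_disc. destruct (Rle_dec (Cmod z) r) as [H|H]; [exact H|].
  rewrite Cmod_mult, Cmod_R, Rabs_pos_eq by (apply Rle_mult_inv_pos; lra).
  apply Req_le. field. lra.
Qed.

Lemma proj_disc_obtuse (r : R) (x y : C) : 0 <= r -> Cmod y <= r ->
  dot (x - proj_disc r x)%C (y - proj_disc r x)%C <= 0.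
Proof.
  intros Hr Hy. unfold proj_disc. destruct (Rle_dec (Cmod x) r) as [H|H].
  - unfold dot. simpl. lra.
  - set (k := r / Cmod x).
    assert (Hk : 0 <= k) by (apply Rle_mult_inv_pos; lra).
    assert (Hk1 : k * Cmod x = r) by (unfold k; field; lra).
    assert (Hk2 : k < 1) by nra.
    pose proof (dot_le x y) as D1. pose proof (dot_self x) as D2.
    replace (dot (x - k * x)%C (y - k * x)%C) with ((1 - k) * (dot x y - k * dot x x))
      by (unfold dot; simpl; ring).
    rewrite D2. assert (E : k * Cmod x ^ 2 = r * Cmod x) by (simpl; rewrite <- Hk1; ring). rewrite E.
    pose proof (Cmod_ge_0 x).
    assert (dot x y - r * Cmod x <= 0) by nra. nra.
Qed.

(** Adding the two obtuse-angle inequalities gives |px - py|^2 <= <x - y, px - py>; the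
    Cauchy-Schwarz inequality finishes. *)
Lemma proj_disc_nonexpansive (r : R) (x y : C) : 0 <= r ->
  Cmod (proj_disc r x - proj_disc r y)%C <= Cmod (x - y)%C.
Proof.
  intros Hr.
  pose proof (proj_disc_obtuse r x (proj_disc r y) Hr (proj_disc_le r y Hr)) as H1.
  pose proof (proj_disc_obtuse r y (proj_disc r x) Hr (proj_disc_le r x Hr)) as H2.
  set (px := proj_disc r x) in *. set (py := proj_disc r y) in *.
  pose proof (dot_le (x - y)%C (px - py)%C) as H3.
  assert (H4 : dot (px - py)%C (px - py)%C <= dot (x - y)%C (px - py)%C) by (unfold dot in *; simpl in *; lra).
  rewrite dot_self in H4. pose proof (Cmod_ge_0 (px - py)%C). pose proof (Cmod_ge_0 (x - y)%C).
  apply Rnot_lt_le. intros L. simpl in H4. nra.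
Qed.

Lemma contraction_fixed_point (T : C -> C) (r q : R) : 0 <= r -> 0 <= q < 1 ->
  (forall z, Cmod z <= r -> Cmod (T z) <= r) ->
  (forall x y, Cmod x <= r -> Cmod y <= r -> Cmod (T x - T y)%C <= q * Cmod (x - y)%C) ->
  exists X, Cmod X <= r /\ T X = X.
Proof.
  intros Hr Hq HT Hc.
  set (u := fix u (n : nat) : C := match n with O => 0%C | S n => T (u n) end).
  assert (Hu : forall n, Cmod (u n) <= r).
  { induction n as [|n IH]; simpl; [rewrite Cmod_0; lra|now apply HT]. }
  set (K := Cmod (u 1%nat - u 0%nat)%C). assert (HK : 0 <= K) by apply Cmod_ge_0.
  assert (Hstep : forall n, Cmod (u (S n) - u n)%C <= K * q ^ n).
  { induction n as [|n IH]; [unfold K; simpl; lra|].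
    change (u (S (S n))) with (T (u (S n))). change (u (S n)) with (T (u n)) at 2.
    eapply Rle_trans; [apply Hc; apply Hu|]. simpl pow.
    apply (Rmult_le_compat_l q) in IH; lra. }
  destruct (geometric_limit u K q Hq HK Hstep) as [X HX].
  assert (Hlim : forall eps, 0 < eps -> exists n, K / (1 - q) * q ^ n < eps).
  { intros eps Heps. assert (0 <= K / (1 - q)) by (apply Rle_mult_inv_pos; lra).
    destruct (pow_lt_1_zero q ltac:(rewrite Rabs_pos_eq; lra) (eps / (K / (1 - q) + 1))) as [N HN].
    { apply Rdiv_lt_0_compat; lra. }
    exists N. specialize (HN N (le_n N)). assert (Pq : 0 <= q ^ N) by (apply pow_le; lra).
    rewrite Rabs_pos_eq in HN by exact Pq.
    apply (Rmult_lt_compat_l (K / (1 - q) + 1)) in HN; [|lra].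
    replace ((K / (1 - q) + 1) * (eps / (K / (1 - q) + 1))) with eps in HN by (field; lra). lra. }
  assert (HXr : Cmod X <= r).
  { apply Rle_plus_epsilon. intros eps Heps. destruct (Hlim eps Heps) as [n Hn].
    specialize (HX n). specialize (Hu n).
    pose proof (Cmod_le_plus X (X - u n)%C (u n) ltac:(ring)) as H. rewrite Cmod_minus_sym in H. lra. }
  exists X. split; [exact HXr|].
  assert (E : (T X - X)%C = 0%C).
  { apply Cmod_eq_0, Rle_antisym; [|apply Cmod_ge_0].
    apply Rle_plus_epsilon. intros eps Heps. destruct (Hlim (eps / 2) ltac:(lra)) as [n Hn].
    pose proof (HX n) as H1. pose proof (HX (S n)) as H2.
    pose proof (Hc X (u n) HXr (Hu n)) as H3. change (T (u n)) with (u (S n)) in H3.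
    rewrite Cmod_minus_sym in H1.
    assert (0 <= K / (1 - q) * q ^ n).
    { apply Rmult_le_pos; [apply Rle_mult_inv_pos; lra|apply pow_le; lra]. }
    simpl in H2. pose proof (Cmod_ge_0 (X - u n)%C).
    pose proof (Cmod_dist_triangle (T X) (u (S n)) X) as Tr. change (T (u n)) with (u (S n)) in H2.
    assert (q * Cmod (X - u n)%C <= Cmod (X - u n)%C) by nra.
    assert (K / (1 - q) * (q * q ^ n) <= K / (1 - q) * q ^ n) by nra. lra. }
  replace (T X) with (T X - X + X)%C by ring. rewrite E. ring.
Qed.

(** * Strictly monotone harmonic maps and the rays filling the complement *)

Section Monotone.
Variables s t s' t' : C -> C.
Hypothesis Hs : holo s s'.
Hypothesis Ht : holo t t'.
Hypothesis Hpos : forall z, unit_disc z -> Cmod (t' z) < Re (s' z).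
Notation f := (harm s t).

(** [dot e f = Re (conj e s + e t)], a real part of an analytic function. *)
Lemma harm_mvt (e z w : C) : unit_disc z -> unit_disc w ->
  exists c, 0 <= c <= 1 /\ dot e (f w - f z)%C =
    Re (Cconj e * (s' (z + c * (w - z)) * (w - z)) + e * (t' (z + c * (w - z)) * (w - z)))%C.
Proof.
  intros Hz Hw.
  set (G := fun c : R => (Cconj e * s (z + c * (w - z)) + e * t (z + c * (w - z)))%C).
  set (dG := fun c : R => (Cconj e * (s' (z + c * (w - z)) * (w - z)) + e * (t' (z + c * (w - z)) * (w - z)))%C).
  assert (HG : forall c, 0 <= c <= 1 -> is_derive (fun c => Re (G c)) c (Re (dG c))).
  { intros c Hc. pose proof (unit_disc_convex z w c Hc Hz Hw) as Hin.
    apply rdiff_Re. eapply rdiff_eq.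
    - apply rdiff_plus; (apply (rdiff_mult (fun _ => _)); [apply rdiff_const|]).
      + apply (rdiff_comp s); [now apply Hs|apply rdiff_affine].
      + apply (rdiff_comp t); [now apply Ht|apply rdiff_affine].
    - unfold dG. cbv beta. ring. }
  destruct (MVT_gen (fun c => Re (G c)) 0 1 (fun c => Re (dG c))) as [c [Hc E]];
    rewrite ?Rmin_left, ?Rmax_right in * by lra.
  - intros c Hc. apply HG. lra.
  - intros c Hc. apply continuity_pt_filterlim, (ex_derive_continuous (fun c => Re (G c))).
    eexists. now apply HG.
  - exists c. split; [exact Hc|]. fold (dG c). rewrite Rminus_0_r, Rmult_1_r in E. rewrite <- E.
    unfold G. replace (z + 1%R * (w - z))%C with w by ring. replace (z + 0%R * (w - z))%C with z by ring.
    unfold harm, dot, Re. simpl. ring.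
Qed.

(** When the test vector of [harm_mvt] is the increment [d] itself, the [p] term is |d|^2 Re p and
    the [q] term is at least -|d|^2 |q|. *)
Lemma harm_monotone_at (d p q : C) :
  Cmod d ^ 2 * (Re p - Cmod q) <= Re (Cconj d * (p * d) + d * (q * d))%C.
Proof.
  pose proof (re_le_Cmod (d * (q * d))%C) as H. rewrite !Cmod_mult in H.
  pose proof (Rabs_maj2 (Re (d * (q * d))%C)).
  replace (Re (Cconj d * (p * d) + d * (q * d))%C) with (Cmod d ^ 2 * Re p + Re (d * (q * d))%C).
  - assert (Cmod d * (Cmod q * Cmod d) = Cmod d ^ 2 * Cmod q) by ring. lra.
  - rewrite Cmod2_alt. unfold Re, Im. simpl. ring.
Qed.

Lemma harm_monotone (z w : C) : unit_disc z -> unit_disc w -> z <> w ->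
  0 < dot (w - z)%C (f w - f z)%C.
Proof.
  intros Hz Hw Hne. destruct (harm_mvt (w - z)%C z w Hz Hw) as [c [Hc ->]].
  eapply Rlt_le_trans; [|apply harm_monotone_at].
  pose proof (Hpos _ (unit_disc_convex z w c Hc Hz Hw)).
  apply Rmult_lt_0_compat; [|lra]. apply pow_lt, Cmod_gt_0. intros E. apply Hne.
  replace w with (w - z + z)%C by ring. rewrite E. ring.
Qed.

Lemma harm_injective : univalent_on_disc f.
Proof.
  intros z w Hz Hw E. apply NNPP. intros Hne. pose proof (harm_monotone z w Hz Hw Hne) as H.
  rewrite E in H. unfold dot in H. simpl in H. lra.
Qed.

Lemma Re_minus_le (a b : C) : Re a - Cmod (b - a)%C <= Re b.
Proof.
  pose proof (re_le_Cmod (b - a)%C) as H. pose proof (Rabs_maj2 (Re (b - a)%C)) as H1.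
  change (Re (b - a)%C) with (Re b - Re a) in *. lra.
Qed.

Lemma Cmod_near_le (a b : C) : Cmod b <= Cmod a + Cmod (b - a)%C.
Proof. pose proof (Cmod_le_plus b a (b - a)%C ltac:(ring)). lra. Qed.

Variables s'' t'' : C -> C.
Hypothesis Hs' : holo s' s''.
Hypothesis Ht' : holo t' t''.

Lemma strong_monotone (r : R) : r < 1 -> exists m, 0 < m /\ forall z w, Cmod z <= r -> Cmod w <= r ->
  m * Cmod (w - z)%C ^ 2 <= dot (w - z)%C (f w - f z)%C.
Proof.
  intros Hr.
  destruct (disc_uniform r (fun z d => d <= Re (s' z) - Cmod (t' z))) as [m [Hm Hall]].
  - intros z a b H1 H2 H3. lra.
  - intros z Hz. assert (Hu : unit_disc z) by (unfold unit_disc; lra).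
    pose proof (Hpos z Hu) as P. set (m := Re (s' z) - Cmod (t' z)) in *.
    assert (Hm : 0 < m) by (unfold m; lra).
    (* Two perturbations below m/4 leave a gap above m/2. *)
    destruct (cdiff_continuous _ _ _ (Hs' z Hu) (m / 4)) as [d1 [Hd1 H1]]; [lra|].
    destruct (cdiff_continuous _ _ _ (Ht' z Hu) (m / 4)) as [d2 [Hd2 H2]]; [lra|].
    exists (Rmin (Rmin d1 d2) (m / 2)). split; [repeat apply Rmin_glb_lt; lra|].
    intros w _ Hw. apply Rmin_Rgt in Hw. destruct Hw as [Hw _].
    apply Rmin_Rgt in Hw. destruct Hw as [Hw1 Hw2].
    specialize (H1 w Hw1). specialize (H2 w Hw2).
    pose proof (Re_minus_le (s' z) (s' w)). pose proof (Cmod_near_le (t' z) (t' w)).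
    eapply Rle_trans; [apply Rmin_r|]. unfold m in *. lra.
  - exists m. split; [exact Hm|]. intros z w Hz Hw.
    destruct (harm_mvt (w - z)%C z w) as [c [Hc ->]]; [unfold unit_disc; lra|unfold unit_disc; lra|].
    eapply Rle_trans; [|apply harm_monotone_at]. rewrite Rmult_comm.
    apply Rmult_le_compat_l; [apply pow2_ge_0|]. apply Hall. now apply Cmod_convex.
Qed.

(** Taking the increment [D] of [f] as test vector in [harm_mvt] turns a scalar mean value theorem
    into a bound on |D|: it reads |D|^2 <= |D| (|s'| + |t'|) |w - z|. *)
Lemma lipschitz (r : R) : r < 1 -> exists L, 0 < L /\ forall z w, Cmod z <= r -> Cmod w <= r ->
  Cmod (f w - f z)%C <= L * Cmod (w - z)%C.
Proof.
  intros Hr.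
  destruct (disc_uniform r (fun z d => Cmod (s' z) + Cmod (t' z) <= / d)) as [d [Hd Hall]].
  - intros z a b H1 H2 H3. eapply Rle_trans; [exact H1|]. now apply Rinv_le_contravar.
  - intros z Hz. assert (Hu : unit_disc z) by (unfold unit_disc; lra).
    pose proof (Cmod_ge_0 (s' z)). pose proof (Cmod_ge_0 (t' z)).
    destruct (cdiff_continuous _ _ _ (Hs' z Hu) 1 Rlt_0_1) as [d1 [Hd1 H1]].
    destruct (cdiff_continuous _ _ _ (Ht' z Hu) 1 Rlt_0_1) as [d2 [Hd2 H2]].
    set (K := Cmod (s' z) + Cmod (t' z) + 2).
    assert (HK : 0 < / K) by (apply Rinv_0_lt_compat; unfold K; lra).
    assert (HM : 0 < Rmin (Rmin d1 d2) (/ K)) by (repeat apply Rmin_glb_lt; lra).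
    exists (Rmin (Rmin d1 d2) (/ K)). split; [exact HM|].
    intros w _ Hw.
    assert (I : K <= / Rmin (Rmin d1 d2) (/ K)).
    { rewrite <- (Rinv_inv K) at 1. apply Rinv_le_contravar; [exact HM|apply Rmin_r]. }
    apply Rmin_Rgt in Hw. destruct Hw as [Hw _].
    apply Rmin_Rgt in Hw. destruct Hw as [Hw1 Hw2].
    specialize (H1 w Hw1). specialize (H2 w Hw2).
    pose proof (Cmod_near_le (s' z) (s' w)). pose proof (Cmod_near_le (t' z) (t' w)).
    unfold K in *. lra.
  - exists (/ d). split; [now apply Rinv_0_lt_compat|]. intros z w Hz Hw.
    set (D := (f w - f z)%C).
    destruct (harm_mvt D z w) as [c [Hc E]]; [unfold unit_disc; lra|unfold unit_disc; lra|].
    fold D in E. rewrite dot_self in E.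
    specialize (Hall (z + c * (w - z))%C ltac:(now apply Cmod_convex)).
    revert E. generalize (s' (z + c * (w - z))%C), (t' (z + c * (w - z))%C), Hall.
    intros p q Hpq E.
    pose proof (re_le_Cmod (Cconj D * (p * (w - z)) + D * (q * (w - z)))%C) as H1.
    pose proof (Rle_abs (Re (Cconj D * (p * (w - z)) + D * (q * (w - z)))%C)) as H2.
    pose proof (Cmod_triangle (Cconj D * (p * (w - z))) (D * (q * (w - z))))%C as H3.
    rewrite !Cmod_mult, Cmod_conj in H3.
    pose proof (Cmod_ge_0 D) as PD. pose proof (Cmod_ge_0 (w - z)%C) as PW.
    assert (H4 : Cmod D ^ 2 <= Cmod D * ((Cmod p + Cmod q) * Cmod (w - z)%C)) by lra.
    assert (H5 : (Cmod p + Cmod q) * Cmod (w - z)%C <= / d * Cmod (w - z)%C) by (apply Rmult_le_compat_r; lra).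
    destruct (Req_dec (Cmod D) 0) as [Z|Z].
    + rewrite Z. apply Rmult_le_pos; [apply Rlt_le, Rinv_0_lt_compat; lra|lra].
    + apply (Rmult_le_reg_l (Cmod D)); [lra|]. simpl in H4. nra.
Qed.

(** The variational inequality [w - f z] normal to the disc of radius [r] at [z], solved as the
    fixed point of the projected gradient map [z |-> proj (z - c (f z - w))], which contracts
    for small [c]. *)
Lemma variational_inequality (r : R) (w : C) : 0 < r < 1 ->
  exists z, Cmod z <= r /\ (f z = w \/ (Cmod z = r /\ exists tau : R, 0 < tau /\ w = (f z + tau * z)%C)).
Proof.
  intros Hr.
  destruct (strong_monotone r ltac:(lra)) as [m [Hm Hmono]].
  destruct (lipschitz r ltac:(lra)) as [L0 [HL0 HLip0]].
  (* Enlarging the Lipschitz constant beyond [m] makes [1 - m^2 / L^2] positive, so that its square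
     root can serve as the contraction factor. *)
  set (L := L0 + m).
  assert (HL : m < L) by (unfold L; lra).
  assert (HLip : forall z w, Cmod z <= r -> Cmod w <= r -> Cmod (f w - f z)%C <= L * Cmod (w - z)%C).
  { intros x y Hx Hy. eapply Rle_trans; [now apply HLip0|].
    apply Rmult_le_compat_r; [apply Cmod_ge_0|unfold L; lra]. }
  (* The step minimising [1 - 2 c m + c^2 L^2], which bounds the squared contraction factor; the
     minimum is [1 - m^2 / L^2]. *)
  set (c := m / (L * L)). assert (HLL : 0 < L * L) by nra.
  assert (Hc : 0 < c) by (apply Rdiv_lt_0_compat; lra).
  assert (Hq0 : m * m / (L * L) < 1) by (apply Rlt_div_l; nra).
  assert (Hq1 : 0 < m * m / (L * L)) by (apply Rdiv_lt_0_compat; nra).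
  set (q := sqrt (1 - m * m / (L * L))).
  assert (Hqq : q * q = 1 - m * m / (L * L)) by (apply sqrt_sqrt; lra).
  assert (Hq : 0 <= q < 1).
  { split; [apply sqrt_pos|]. apply Rnot_le_lt. intros H. nra. }
  destruct (contraction_fixed_point (fun z => proj_disc r (z - c * (f z - w))%C) r q) as [z [Hz E]];
    [lra|exact Hq|intros z Hz; apply proj_disc_le; lra| |].
  - intros x y Hx Hy. eapply Rle_trans; [apply proj_disc_nonexpansive; lra|].
    set (d := (x - y)%C). set (D := (f x - f y)%C).
    replace (x - c * (f x - w) - (y - c * (f y - w)))%C with (d - c * D)%C by (unfold d, D; ring).
    pose proof (Hmono y x Hy Hx) as M1. pose proof (HLip y x Hy Hx) as M2. fold d D in M1, M2.
    pose proof (Cmod_ge_0 d) as Pd. pose proof (Cmod_ge_0 D) as PD.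
    assert (M3 : Cmod D ^ 2 <= L * L * Cmod d ^ 2) by (simpl; nra).
    assert (S : Cmod (d - c * D)%C ^ 2 <= (q * Cmod d) ^ 2).
    { rewrite <- dot_self.
      replace (dot (d - c * D)%C (d - c * D)%C) with (dot d d - 2 * c * dot d D + c * c * dot D D)
        by (unfold dot; simpl; ring).
      rewrite !dot_self.
      assert (A1 : c * (m * Cmod d ^ 2) <= c * dot d D) by (apply Rmult_le_compat_l; lra).
      assert (A2 : c * c * Cmod D ^ 2 <= c * c * (L * L * Cmod d ^ 2)) by (apply Rmult_le_compat_l; nra).
      replace ((q * Cmod d) ^ 2) with (q * q * Cmod d ^ 2) by ring. rewrite Hqq.
      assert (A3 : c * m = m * m / (L * L)) by (unfold c; field; lra).
      assert (A4 : c * c * (L * L * Cmod d ^ 2) = m * m / (L * L) * Cmod d ^ 2) by (unfold c; field; lra).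
      rewrite A4 in A2. rewrite <- Rmult_assoc, A3 in A1. lra. }
    apply Rsqr_incr_0_var; [|apply Rmult_le_pos; lra]. unfold Rsqr. simpl in S. lra.
  - exists z. split; [exact Hz|].
    set (v := (z - c * (f z - w))%C) in E. unfold proj_disc in E.
    assert (Nc : RtoC c <> 0%C) by (intros H; apply (f_equal fst) in H; simpl in H; lra).
    (* If the projection does not move [v], then [v = z] and [f z = w]. Otherwise [z] is [v] scaled
       back to radius [r], and [w - f z = (v - z) / c] is a positive multiple of [z]. *)
    destruct (Rle_dec (Cmod v) r) as [Hv|Hv].
    + left. transitivity (w + (z - v) / c)%C; [unfold v; field; exact Nc|].
      rewrite E. field. exact Nc.
    + right. apply Rnot_le_lt in Hv. split.
      * rewrite <- E, Cmod_mult, Cmod_R, Rabs_pos_eq by (apply Rle_mult_inv_pos; lra). field. lra.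
      * exists ((Cmod v / r - 1) / c). split.
        { apply Rdiv_lt_0_compat; [|exact Hc]. apply Rlt_0_minus, Rlt_div_r; lra. }
        assert (Nv : RtoC (Cmod v) <> 0%C) by (intros H; apply (f_equal fst) in H; simpl in H; lra).
        assert (Nr : RtoC r <> 0%C) by (intros H; apply (f_equal fst) in H; simpl in H; lra).
        assert (V : v = ((Cmod v / r)%R * z)%C).
        { rewrite <- E. rewrite !RtoC_div by lra. field. split; trivial. }
        transitivity (f z + (v - z) / c)%C; [unfold v; field; exact Nc|].
        rewrite RtoC_div, RtoC_minus by lra. rewrite V at 1. field. exact Nc.
Qed.

(** A term [tau * z] with |z| = r has non-negative product with [z - z0], so strong monotonicity
    bounds m |z - z0| by |w - f z0| in either case of the variational inequality. For [w] this close
    to [f z0] the solution cannot reach the circle of radius [r], hence [f z = w]. The same bound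
    makes the inverse continuous. *)
Lemma image_near (z0 : C) : unit_disc z0 -> exists m r, 0 < m /\ Cmod z0 < r < 1 /\
  forall w, Cmod (w - f z0)%C < m * (r - Cmod z0) ->
    exists z, unit_disc z /\ f z = w /\ m * Cmod (z - z0)%C <= Cmod (w - f z0)%C.
Proof.
  intros H0. unfold unit_disc in H0. pose proof (Cmod_ge_0 z0) as P0.
  set (r := (1 + Cmod z0) / 2). assert (Hr : Cmod z0 < r < 1) by (unfold r; lra).
  destruct (strong_monotone r ltac:(lra)) as [m [Hm Hmono]].
  exists m, r. split; [exact Hm|split; [exact Hr|]]. intros w Hw.
  destruct (variational_inequality r w ltac:(lra)) as [z [Hz Hcase]].
  specialize (Hmono z0 z ltac:(lra) Hz).
  assert (Hd : m * Cmod (z - z0)%C ^ 2 <= dot (z - z0)%C (w - f z0)%C).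
  { destruct Hcase as [<-|[Hzr [tau [Htau ->]]]]; [exact Hmono|].
    replace (dot (z - z0)%C (f z + tau * z - f z0)%C) with
      (dot (z - z0)%C (f z - f z0)%C + tau * (dot z z - dot z0 z)) by (unfold dot; simpl; ring).
    rewrite dot_self. pose proof (dot_le z0 z) as D. rewrite Hzr in *.
    assert (0 <= tau * (r ^ 2 - dot z0 z)) by (apply Rmult_le_pos; simpl; nra). lra. }
  pose proof (dot_le (z - z0)%C (w - f z0)%C) as D.
  assert (B : m * Cmod (z - z0)%C <= Cmod (w - f z0)%C).
  { pose proof (Cmod_ge_0 (z - z0)%C) as Pz. destruct (Req_dec (Cmod (z - z0)%C) 0) as [Z|Z].
    - rewrite Z. pose proof (Cmod_ge_0 (w - f z0)%C). lra.
    - apply (Rmult_le_reg_l (Cmod (z - z0)%C)); [lra|]. simpl in Hd. lra. }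
  exists z. split; [unfold unit_disc; lra|]. split; [|exact B].
  destruct Hcase as [E|[Hzr _]]; [exact E|]. exfalso.
  pose proof (Cmod_near_le z0 z). rewrite Hzr in *.
  assert (m * (r - Cmod z0) <= m * Cmod (z - z0)%C) by (apply Rmult_le_compat_l; lra). lra.
Qed.

(** The variational inequality in Minty's form: [f] is evaluated at the test point [z] and not at
    [zeta], where it need not have a limit. *)
Definition support_ray (p zeta : C) : Prop :=
  Cmod zeta = 1 /\ forall z, unit_disc z -> 0 <= dot (z - zeta)%C (f z - p)%C.

Lemma support_ray_disjoint (p zeta : C) (r : R) : support_ray p zeta -> 0 <= r ->
  ~ image_disc f (p + r * zeta)%C.
Proof.
  intros [H1 H] Hr [z0 [Hz0 E]]. pose proof Hz0 as Hu. unfold unit_disc in Hu.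
  (* At the midpoint [z - zeta] is [-(z - z0)], so the support inequality contradicts monotonicity
     between [z0] and [z]; the ray parameter contributes [r * (dot z zeta - 1) <= 0]. *)
  set (z := (z0 + (/ 2)%R * (zeta - z0))%C).
  assert (Hz : unit_disc z).
  { unfold unit_disc, z. eapply Rle_lt_trans; [apply (Cmod_le_plus _ ((/ 2)%R * z0)%C ((/ 2)%R * zeta)%C)|].
    - apply injective_projections; simpl; field.
    - rewrite !Cmod_mult, !Cmod_R, Rabs_pos_eq by lra. lra. }
  assert (Hne : z0 <> z).
  { intros Eq. assert (Z : zeta = z0).
    { transitivity (2%R * (z - z0) + z0)%C; [unfold z; apply injective_projections; simpl; field|].
      rewrite <- Eq. ring. }
    rewrite Z in H1. lra. }
  pose proof (harm_monotone z0 z Hz0 Hz Hne) as M. specialize (H z Hz).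
  pose proof (dot_le z zeta) as D. rewrite H1 in D. unfold unit_disc in Hz.
  assert (Dz : dot zeta zeta = 1) by (rewrite dot_self, H1; ring).
  assert (S : dot (z - zeta)%C (f z - p)%C = - dot (z - z0)%C (f z - f z0)%C + r * (dot z zeta - dot zeta zeta)).
  { rewrite E. unfold z, dot. simpl. field. }
  assert (0 <= r * (dot zeta zeta - dot z zeta)) by (apply Rmult_le_pos; lra). lra.
Qed.

Lemma support_ray_exists (w : C) : ~ image_disc f w -> exists zeta, support_ray w zeta.
Proof.
  intros Hw.
  assert (Hn : forall n : nat, exists z, Cmod z = 1 - / (INR n + 2) /\
    forall y, Cmod y <= 1 - / (INR n + 2) -> 0 <= dot (y - z)%C (f y - w)%C).
  { intros n. pose proof (pos_INR n) as Pn. set (r := 1 - / (INR n + 2)).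
    assert (I0 : 0 < / (INR n + 2)) by (apply Rinv_0_lt_compat; lra).
    assert (I1 : / (INR n + 2) < 1) by (rewrite <- Rinv_1; apply Rinv_lt_contravar; lra).
    assert (Hr : 0 < r < 1) by (unfold r; lra).
    destruct (variational_inequality r w Hr) as [z [Hz [E|[Hzr [tau [Htau E]]]]]].
    { exfalso. apply Hw. exists z. split; [unfold unit_disc; lra|exact E]. }
    exists z. split; [exact Hzr|]. intros y Hy.
    (* <y - z, f y - w> splits into <y - z, f y - f z> and tau (|z|^2 - <y, z>); the first is
       non-negative by monotonicity, the second because |y| <= |z| = r. *)
    destruct (strong_monotone r ltac:(lra)) as [m [Hm Hmono]].
    specialize (Hmono z y Hz Hy). pose proof (pow2_ge_0 (Cmod (y - z)%C)) as Q.
    assert (Hmq : 0 <= m * Cmod (y - z)%C ^ 2) by (apply Rmult_le_pos; lra).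
    pose proof (dot_le y z) as D. rewrite Hzr in D.
    assert (Dz : dot z z = r ^ 2) by (rewrite dot_self, Hzr; ring).
    replace (dot (y - z)%C (f y - w)%C) with (dot (y - z)%C (f y - f z)%C + tau * (dot z z - dot y z)).
    - rewrite Dz. assert (0 <= tau * (r ^ 2 - dot y z)) by (apply Rmult_le_pos; simpl; nra). lra.
    - rewrite E. unfold dot. simpl. ring. }
  destruct (choice _ Hn) as [u Hu].
  assert (I0 : forall n, 0 < / (INR n + 2)).
  { intros n. pose proof (pos_INR n). apply Rinv_0_lt_compat. lra. }
  destruct (disc_cluster_point u) as [zeta Hz].
  { intros n. destruct (Hu n) as [-> _]. specialize (I0 n). lra. }
  assert (Small : forall eps, 0 < eps -> exists N, forall n, (N <= n)%nat -> / (INR n + 2) < eps).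
  { intros eps Heps. destruct (INR_unbounded (/ eps)) as [N HN]. exists N. intros n Hle.
    apply le_INR in Hle. rewrite <- (Rinv_inv eps). apply Rinv_lt_contravar; [|lra].
    assert (0 < / eps) by now apply Rinv_0_lt_compat. pose proof (pos_INR n). nra. }
  exists zeta. split.
  - apply Rle_antisym; apply Rle_plus_epsilon; intros eps Heps.
    + destruct (Hz eps Heps 0%nat) as [n [_ H]]. destruct (Hu n) as [E _]. specialize (I0 n).
      pose proof (Cmod_near_le (u n) zeta). rewrite Cmod_minus_sym in H. lra.
    + destruct (Small (eps / 2) ltac:(lra)) as [N HN].
      destruct (Hz (eps / 2) ltac:(lra) N) as [n [Hle H]]. destruct (Hu n) as [E _]. specialize (HN n Hle).
      pose proof (Cmod_near_le zeta (u n)). lra.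
  - intros z Hzu. unfold unit_disc in Hzu.
    apply Rle_plus_epsilon. intros eps Heps.
    (* From [N] on [z] lies in the disc of index [n] and may be tested against [u n]; replacing
       [u n] by [zeta] costs at most [K] times their distance. *)
    destruct (Small (1 - Cmod z) ltac:(lra)) as [N HN].
    set (K := Cmod (f z - w)%C). assert (HK : 0 <= K) by apply Cmod_ge_0.
    destruct (Hz (eps / (K + 1)) ltac:(apply Rdiv_lt_0_compat; lra) N) as [n [Hle H]].
    specialize (HN n Hle). destruct (Hu n) as [_ Hmin]. specialize (Hmin z ltac:(lra)).
    pose proof (dot_ge (u n - zeta)%C (f z - w)%C) as D. fold K in D.
    apply Rlt_le in H. apply (Rmult_le_compat_l (K + 1)) in H; [|lra].
    replace ((K + 1) * (eps / (K + 1))) with eps in H by (field; lra).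
    pose proof (Cmod_ge_0 (u n - zeta)%C).
    assert (S : dot (z - zeta)%C (f z - w)%C = dot (z - u n)%C (f z - w)%C + dot (u n - zeta)%C (f z - w)%C)
      by (unfold dot; simpl; ring).
    lra.
Qed.

(** Testing both support inequalities at the midpoint of [z1] and [z2] shows that the rays are
    directed monotonically, which prevents them from crossing. *)
Lemma support_ray_noncrossing (p1 z1 p2 z2 : C) :
  support_ray p1 z1 -> support_ray p2 z2 -> ~ crossing p1 z1 p2 z2.
Proof.
  intros [N1 H1] [N2 H2] [Him [w [[r1 [Hr1 E1]] [[r2 [Hr2 E2]] [Hw1 _]]]]].
  assert (Pr1 : 0 < r1).
  { destruct Hr1 as [L|<-]; [exact L|]. exfalso. apply Hw1. rewrite E1. ring. }
  assert (D1 : dot z1 z1 = 1) by (rewrite dot_self, N1; ring).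
  assert (D2 : dot z2 z2 = 1) by (rewrite dot_self, N2; ring).
  assert (Hc : dot z1 z2 < 1).
  { apply Rnot_le_lt. intros Hge.
    assert (Id : dot (z1 - z2)%C (z1 - z2)%C = dot z1 z1 - 2 * dot z1 z2 + dot z2 z2) by (unfold dot; simpl; ring).
    assert (Ez : z1 = z2).
    { rewrite dot_self, D1, D2 in Id. simpl in Id. pose proof (Cmod_ge_0 (z1 - z2)%C).
      assert (Z : (z1 - z2)%C = 0%C) by (apply Cmod_eq_0; nra).
      replace z1 with (z1 - z2 + z2)%C by ring. rewrite Z. ring. }
    apply Him. rewrite Ez. simpl. ring. }
  set (m := ((/ 2)%R * (z1 + z2))%C).
  assert (Hm : unit_disc m).
  { unfold unit_disc. apply Rnot_le_lt. intros Hge.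
    assert (Q : dot m m = / 4 * (dot z1 z1 + 2 * dot z1 z2 + dot z2 z2)) by (unfold m, dot; simpl; field).
    rewrite dot_self in Q. simpl in Q. nra. }
  specialize (H1 m Hm). specialize (H2 m Hm).
  (* [m - z1] and [m - z2] are opposite, so [f m] cancels. What remains is (r1 + r2) (<z1, z2> - 1)
     / 2, negative since the unit vectors differ and [r1 > 0]. *)
  assert (Sum : dot (m - z1)%C (f m - p1)%C + dot (m - z2)%C (f m - p2)%C
    = / 2 * (r1 * (dot z1 z2 - dot z1 z1) + r2 * (dot z1 z2 - dot z2 z2))).
  { replace p1 with (w - r1 * z1)%C by (rewrite E1; ring).
    replace p2 with (w - r2 * z2)%C by (rewrite E2; ring).
    unfold m, dot. simpl. field. }
  rewrite D1, D2 in Sum. nra.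
Qed.

End Monotone.

(** * Topology of the image *)

Lemma C_ball_Cmod (z w : C) (e : R) : Cmod (w - z)%C < e -> @ball C_UniformSpace z e w.
Proof.
  intros H. split.
  - eapply Rle_lt_trans; [|exact H]. exact (re_le_Cmod (w - z)%C).
  - eapply Rle_lt_trans; [|exact H]. exact (im_le_Cmod (w - z)%C).
Qed.

(** Balls of the uniform structure on C are squares, whence the factor 1/2. *)
Lemma Cmod_C_ball (z w : C) (e : R) : @ball C_UniformSpace z (e / 2) w -> Cmod (w - z)%C < e.
Proof.
  intros [H1 H2]. eapply Rle_lt_trans; [apply Cmod_le_Re_Im|].
  change (Rabs (fst w - fst z) < e / 2) in H1. change (Rabs (snd w - snd z) < e / 2) in H2.
  change (Rabs (fst w - fst z) + Rabs (snd w - snd z) < e). lra.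
Qed.

Lemma continuous_eps_delta (f : C -> C) (z : C) :
  (forall eps, 0 < eps -> exists del, 0 < del /\ forall w, Cmod (w - z)%C < del -> Cmod (f w - f z)%C < eps) ->
  @continuous C_UniformSpace C_UniformSpace f z.
Proof.
  intros H P [eps HP]. destruct (H eps (cond_pos eps)) as [d [Hd Hf]].
  assert (Hd2 : 0 < d / 2) by lra. exists (mkposreal _ Hd2). intros w Hw.
  apply HP, C_ball_Cmod, Hf, Cmod_C_ball, Hw.
Qed.

(** Loops and homotopies are continuous on all of R, but lie in the domain on [0,1] only; composing
    with this retraction brings every parameter back to [0,1]. *)
Definition clamp (x : R) : R := Rmax 0 (Rmin 1 x).

Lemma clamp_range (x : R) : 0 <= clamp x <= 1.
Proof. split; [apply Rmax_l|]. apply Rmax_lub; [lra|apply Rmin_l]. Qed.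

Lemma clamp_id (x : R) : 0 <= x <= 1 -> clamp x = x.
Proof. intros H. unfold clamp. rewrite Rmin_right, Rmax_right; lra. Qed.

Lemma clamp_lipschitz (x y : R) : Rabs (clamp x - clamp y) <= Rabs (x - y).
Proof.
  unfold clamp, Rmax, Rmin.
  repeat destruct Rle_dec; unfold Rabs; repeat destruct Rcase_abs; lra.
Qed.

Lemma clamp_continuous (x : R) : continuous clamp x.
Proof.
  intros P [eps HP]. exists eps. intros y Hy. apply HP.
  eapply Rle_lt_trans; [apply clamp_lipschitz|exact Hy].
Qed.

Section Image.
Variable f : C -> C.
Hypothesis f_cont : forall z, unit_disc z -> forall eps, 0 < eps -> exists del, 0 < del /\
  forall w, Cmod (w - z)%C < del -> Cmod (f w - f z)%C < eps.
Hypothesis f_near : forall z0, unit_disc z0 -> exists m r, 0 < m /\ Cmod z0 < r < 1 /\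
  forall w, Cmod (w - f z0)%C < m * (r - Cmod z0) ->
    exists z, unit_disc z /\ f z = w /\ m * Cmod (z - z0)%C <= Cmod (w - f z0)%C.

Lemma image_open : open (image_disc f).
Proof.
  intros w [z0 [H0 <-]]. destruct (f_near z0 H0) as [m [r [Hm [Hr H]]]].
  assert (He : 0 < m * (r - Cmod z0) / 2) by (apply Rdiv_lt_0_compat; [apply Rmult_lt_0_compat; lra|lra]).
  exists (mkposreal _ He). intros v Hv. destruct (H v) as [z [Hz [E _]]]; [now apply Cmod_C_ball|].
  now exists z.
Qed.

Lemma segment_path_continuous (z0 z1 : C) (x : R) : unit_disc z0 -> unit_disc z1 ->
  @continuous R_UniformSpace C_UniformSpace (fun x => f (z0 + clamp x * (z1 - z0))%C) x.
Proof.
  intros H0 H1.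
  apply (@continuous_comp R_UniformSpace C_UniformSpace C_UniformSpace (fun x => z0 + clamp x * (z1 - z0))%C f).
  - apply (@continuous_comp R_UniformSpace R_UniformSpace C_UniformSpace clamp (fun x => z0 + x * (z1 - z0))%C).
    + apply clamp_continuous.
    + eapply rdiff_continuous, rdiff_affine.
  - apply continuous_eps_delta, f_cont, unit_disc_convex; trivial. apply clamp_range.
Qed.

Lemma image_connected : connected_set (image_disc f).
Proof.
  intros [A [B [HA [HB [Hcov [[wa [[z0 [H0 E0]] Ha]] [[wb [[z1 [H1 E1]] Hb]] Hdis]]]]]]].
  set (g := fun x => f (z0 + clamp x * (z1 - z0))%C).
  assert (Hg : forall x, image_disc f (g x)).
  { intros x. eexists. split; [|reflexivity]. apply unit_disc_convex; trivial. apply clamp_range. }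
  (* Along the path the indicator of a separating pair is locally constant, hence continuous, yet it
     takes the values 0 and 1 and never 1/2. *)
  set (u := fun x => if excluded_middle_informative (A (g x)) then 0 else 1).
  assert (Hu : forall x, continuity_pt u x).
  { intros x. apply continuity_pt_filterlim.
    pose proof (segment_path_continuous z0 z1 x H0 H1) as Cg.
    assert (L : locally x (fun y => u x = u y)).
    { destruct (classic (A (g x))) as [Ax|Ax].
      - assert (Q : locally x (fun y => A (g y))) by exact (Cg A (HA _ Ax)).
        revert Q. apply filter_imp. intros y Ay. unfold u.
        destruct (excluded_middle_informative (A (g x))); [|contradiction].
        now destruct (excluded_middle_informative (A (g y))).
      - destruct (Hcov (g x) (Hg x)) as [?|Bx]; [contradiction|].
        assert (Q : locally x (fun y => B (g y))) by exact (Cg B (HB _ Bx)).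
        revert Q. apply filter_imp. intros y By. unfold u.
        destruct (excluded_middle_informative (A (g x))); [contradiction|].
        destruct (excluded_middle_informative (A (g y))) as [Ay|]; [|reflexivity].
        exfalso. now apply (Hdis (g y)). }
    apply (@continuous_ext_loc R_UniformSpace R_UniformSpace u (fun _ => u x) x L), continuous_const. }
  assert (g0 : g 0 = wa).
  { unfold g. rewrite clamp_id by lra. rewrite <- E0. f_equal. ring. }
  assert (g1 : g 1 = wb).
  { unfold g. rewrite clamp_id by lra. rewrite <- E1. f_equal. ring. }
  assert (u0 : u 0 = 0).
  { unfold u. rewrite g0. now destruct (excluded_middle_informative (A wa)). }
  assert (u1 : u 1 = 1).
  { unfold u. rewrite g1. destruct (excluded_middle_informative (A wb)); [|reflexivity].
    exfalso. apply (Hdis wb); trivial. exists z1. now split. }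
  destruct (IVT_gen u 0 1 (/ 2)) as [x [_ Hx]].
  - exact Hu.
  - rewrite u0, u1, Rmin_left, Rmax_right; lra.
  - unfold u in Hx. destruct (excluded_middle_informative (A (g x))); lra.
Qed.

(** The loop is pulled back to the disc by the continuous inverse, shrunk radially to 0 and mapped
    forward again. *)
Lemma image_simply_connected : univalent_on_disc f -> simply_connected (image_disc f).
Proof.
  intros Hinj g Hg HD Hloop.
  assert (Hinv : forall w, exists z, image_disc f w -> unit_disc z /\ f z = w).
  { intros w. destruct (classic (image_disc f w)) as [[z Hz]|N]; [now exists z|].
    exists 0%C. intros; contradiction. }
  destruct (choice _ Hinv) as [inv Hi].
  assert (inv_cont : forall w, image_disc f w -> @continuous C_UniformSpace C_UniformSpace inv w).
  { intros w Hw. destruct (Hi w Hw) as [Hz Ez]. apply continuous_eps_delta. intros eps Heps.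
    destruct (f_near (inv w) Hz) as [m [r [Hm [Hr H]]]]. rewrite Ez in H.
    exists (Rmin (m * (r - Cmod (inv w))) (m * eps)). split.
    { apply Rmin_glb_lt; apply Rmult_lt_0_compat; lra. }
    intros v Hv. apply Rmin_Rgt in Hv. destruct Hv as [Hv1 Hv2].
    destruct (H v Hv1) as [z [Hzu [E B]]].
    destruct (Hi v) as [Hv3 Ev]; [now exists z|].
    replace (inv v) with z by (apply Hinj; congruence).
    apply (Rmult_lt_reg_l m); lra. }
  assert (Hgc : forall x, image_disc f (g (clamp x))) by (intros x; apply HD, clamp_range).
  set (k := fun x => inv (g (clamp x))).
  assert (Hk : forall x, unit_disc (k x) /\ f (k x) = g (clamp x)) by (intros x; apply Hi, Hgc).
  assert (gc_cont : forall x, @continuous R_UniformSpace C_UniformSpace (fun x => g (clamp x)) x).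
  { intros x. apply (@continuous_comp R_UniformSpace R_UniformSpace C_UniformSpace clamp g);
      [apply clamp_continuous|apply Hg]. }
  assert (k_cont : forall x, @continuous R_UniformSpace C_UniformSpace k x).
  { intros x. apply (@continuous_comp R_UniformSpace C_UniformSpace C_UniformSpace (fun x => g (clamp x)) inv);
      [apply gc_cont|apply inv_cont, Hgc]. }
  set (sc := fun (a : R) (v : C) => @scal R_AbsRing C_R_NormedModule a v).
  assert (scE : forall a v, sc a v = (a * v)%C).
  { intros a v. apply injective_projections; simpl; unfold scal; simpl; unfold mult; simpl; ring. }
  (* The second summand is 0 for parameters in [0,1]. It is there because [H (0, x) = g x] is
     required for every real [x], including those where [g x] may leave the image. *)
  set (H := fun p : R * R => @plus C_R_NormedModule (f (sc (1 - clamp (fst p)) (k (snd p))))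
     (sc (1 - clamp (fst p)) (@minus C_R_NormedModule (g (snd p)) (g (clamp (snd p)))))).
  assert (HE : forall u x, H (u, x) = (f ((1 - clamp u)%R * k x) + (1 - clamp u)%R * (g x - g (clamp x)))%C).
  { intros u x. unfold H. simpl fst; simpl snd. rewrite !scE. reflexivity. }
  assert (Hdisc : forall u x, unit_disc ((1 - clamp u)%R * k x)%C).
  { intros u x. destruct (Hk x) as [Hu _]. unfold unit_disc in *. pose proof (clamp_range u).
    rewrite Cmod_mult, Cmod_R, Rabs_pos_eq by lra. pose proof (Cmod_ge_0 (k x)). nra. }
  exists H, (f 0%C). repeat split.
  - intros [u x].
    assert (Cfst : @continuous (prod_UniformSpace R_UniformSpace R_UniformSpace) R_UniformSpace
       (fun p : R * R => 1 - clamp (fst p)) (u, x)).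
    { apply (@continuous_minus (prod_UniformSpace R_UniformSpace R_UniformSpace) R_AbsRing R_NormedModule
        (fun _ => 1) (fun p : R * R => clamp (fst p))); [apply continuous_const|].
      apply (@continuous_comp (prod_UniformSpace R_UniformSpace R_UniformSpace) R_UniformSpace R_UniformSpace fst clamp);
        [apply continuous_fst|apply clamp_continuous]. }
    assert (Csnd : forall h : R -> C, (forall x, @continuous R_UniformSpace C_UniformSpace h x) ->
       @continuous (prod_UniformSpace R_UniformSpace R_UniformSpace) C_UniformSpace
         (fun p : R * R => h (snd p)) (u, x)).
    { intros h Hh. apply (@continuous_comp (prod_UniformSpace R_UniformSpace R_UniformSpace) R_UniformSpace
        C_UniformSpace snd h); [apply continuous_snd|apply Hh]. }
    apply (@continuous_plus (prod_UniformSpace R_UniformSpace R_UniformSpace) R_AbsRing C_R_NormedModule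
      (fun p => f (sc (1 - clamp (fst p)) (k (snd p))))
      (fun p => sc (1 - clamp (fst p)) (@minus C_R_NormedModule (g (snd p)) (g (clamp (snd p)))))).
    + apply (@continuous_comp (prod_UniformSpace R_UniformSpace R_UniformSpace) C_UniformSpace C_UniformSpace
        (fun p => sc (1 - clamp (fst p)) (k (snd p))) f).
      * apply (@continuous_scal (prod_UniformSpace R_UniformSpace R_UniformSpace) R_AbsRing C_R_NormedModule
          (fun p : R * R => 1 - clamp (fst p)) (fun p => k (snd p))); [exact Cfst|exact (Csnd k k_cont)].
      * apply continuous_eps_delta, f_cont. rewrite scE. apply Hdisc.
    + apply (@continuous_scal (prod_UniformSpace R_UniformSpace R_UniformSpace) R_AbsRing C_R_NormedModule
          (fun p : R * R => 1 - clamp (fst p))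
          (fun p => @minus C_R_NormedModule (g (snd p)) (g (clamp (snd p))))); [exact Cfst|].
      apply (@continuous_minus (prod_UniformSpace R_UniformSpace R_UniformSpace) R_AbsRing C_R_NormedModule
        (fun p : R * R => g (snd p)) (fun p => g (clamp (snd p)))).
      * exact (Csnd g Hg).
      * exact (Csnd _ gc_cont).
  - intros x. rewrite HE, clamp_id, Rminus_0_r by lra. destruct (Hk x) as [_ E].
    replace (1%R * k x)%C with (k x) by ring. rewrite E. ring.
  - intros x. rewrite HE, clamp_id by lra. replace (1 - 1) with 0 by ring.
    replace (0%R * k x)%C with (RtoC 0) by ring. ring.
  - intros u Hu. rewrite !HE. unfold k. rewrite !(clamp_id 0), !(clamp_id 1), Hloop by lra. reflexivity.
  - intros u x Hu Hx. rewrite HE. rewrite (clamp_id x Hx).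
    exists ((1 - clamp u)%R * k x)%C. split; [apply Hdisc|]. ring.
Qed.

End Image.

Lemma harm_continuous (s t s' t' : C -> C) : holo s s' -> holo t t' ->
  forall z, unit_disc z -> forall eps, 0 < eps -> exists del, 0 < del /\
    forall w, Cmod (w - z)%C < del -> Cmod (harm s t w - harm s t z)%C < eps.
Proof.
  intros Hs Ht z Hz eps Heps.
  destruct (cdiff_continuous _ _ _ (Hs z Hz) (eps / 2)) as [d1 [Hd1 H1]]; [lra|].
  destruct (cdiff_continuous _ _ _ (Ht z Hz) (eps / 2)) as [d2 [Hd2 H2]]; [lra|].
  exists (Rmin d1 d2). split; [now apply Rmin_glb_lt|].
  intros w Hw. apply Rmin_Rgt in Hw. destruct Hw as [Hw1 Hw2].
  specialize (H1 w Hw1). specialize (H2 w Hw2).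
  eapply Rle_lt_trans; [apply (Cmod_le_plus _ (s w - s z)%C (Cconj (t w - t z)))|].
  - unfold harm. apply injective_projections; simpl; ring.
  - rewrite Cmod_conj. lra.
Qed.

Theorem theorem5 (gamma delta lambda : R) (s t : C -> C) :
  0 <= lambda -> lambda < gamma -> gamma <= delta ->
  in_RH0 gamma delta lambda s t ->
  close_to_convex_on_disc (harm s t).
Proof.
  intros Hl Hg Hd HR.
  pose proof (RH0_derivative_bound gamma delta lambda s t Hl Hg Hd HR) as Hpos.
  destruct HR as [[Hs [Ht _]] _].
  pose proof (holo_C_derive s Hs) as Hs0. pose proof (holo_C_derive t Ht) as Ht0.
  pose proof (holo_C_derive _ (analytic_C_derive s Hs)) as Hs1.
  pose proof (holo_C_derive _ (analytic_C_derive t Ht)) as Ht1.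
  pose proof (harm_injective _ _ _ _ Hs0 Ht0 Hpos) as Hinj.
  pose proof (harm_continuous s t _ _ Hs0 Ht0) as Hcont.
  pose proof (image_near _ _ _ _ Hs0 Ht0 Hpos _ _ Hs1 Ht1) as Hnear.
  split; [exact Hinj|]. split; [split|split].
  - now apply image_open.
  - now apply image_connected.
  - now apply image_simply_connected.
  (* All support rays are taken rather than one chosen for each point: disjointness from the image
     and absence of crossings hold for any of them. *)
  - exists (fun pd => support_ray s t (fst pd) (snd pd)). repeat split.
    + intros [p d] [H1 _] E. simpl in *. rewrite E, Cmod_0 in H1. lra.
    + intros Hw. destruct (support_ray_exists _ _ _ _ Hs0 Ht0 Hpos _ _ Hs1 Ht1 w Hw) as [zeta Hz].
      exists (w, zeta). split; [exact Hz|]. exists 0. simpl. split; [lra|ring].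
    + intros [[p d] [Hray [r [Hr ->]]]]. simpl in *.
      now apply (support_ray_disjoint _ _ _ _ Hs0 Ht0 Hpos).
    + intros [p1 d1] [p2 d2] H1 H2. simpl in *. now apply (support_ray_noncrossing s t).
Qed.
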